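(* Let $n=d=1$ and suppose that $K$, $\mu$, $r$ satisfy the kernel assumption stated in the context. Assume that there exists a Borel set $B\subset\mathrm{supp}\,\mu$ such that $\mu(B)>0$ and $\mu$ is atomless on $B$. Then the transition semigroup $\{P_t\}_{t\ge0}$ associated with the lifted SEE $$\mathrm{d}Y_t(\theta)=-\theta Y_t(\theta)\,\mathrm{d}t+\mathrm{d}W_t,\ t>0,\qquad Y_0(\theta)=y(\theta),\qquad\theta\in\mathrm{supp}\,\mu,$$ is not strongly Feller. More precisely, for any $t>0$, there exists a bounded Borel measurable function $f:\mathcal{H}_\mu\to\mathbb{R}$ such that $y\mapsto P_tf(y)$ is not continuous on $\mathcal{H}_\mu$.
   Context: Setting. $(\Omega,\mathcal{F},\mathbb{F},\mathbb{P})$ is a complete filtered probability space with filtration satisfying the usual conditions, $W$ is a one-dimensional Brownian motion on it. Kernel assumption. $K:(0,\infty)\to[0,\infty)$ is completely monotone, i.e. infinitely differentiable with $(-1)^kK^{(k)}(t)\ge0$ for all $t>0$ and integers $k\ge0$; $\mu$ is the unique Radon measure on $[0,\infty)$ with $K(t)=\int_{[0,\infty)}e^{-\theta t}\mu(\mathrm{d}\theta)$ for all $t>0$ (Bernstein's theorem); $\mathrm{supp}\,\mu$ is its support. There is a non-increasing Borel measurable $r:[0,\infty)\to(0,\infty)$, fixed once and for all, with $1\wedge\theta^{-1/2}\le r(\theta)\le1$ for all $\theta\ge0$ and $\int_{\mathrm{supp}\,\mu}r(\theta)\,\mu(\mathrm{d}\theta)<\infty$. Space and process. $\mathcal{H}_\mu$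 is the separable Hilbert space of ($\mu$-a.e. equivalence classes of) Borel functions $y:\mathrm{supp}\,\mu\to\mathbb{R}$ with $\|y\|_{\mathcal{H}_\mu}^2:=\int_{\mathrm{supp}\,\mu}r(\theta)|y(\theta)|^2\mu(\mathrm{d}\theta)<\infty$. The constant function $1$ belongs to $\mathcal{H}_\mu$. The unique mild solution of the lifted SEE with initial condition $y\in\mathcal{H}_\mu$ is $Y^y_t=e^{-\cdot t}y(\cdot)+\int_0^te^{-\cdot(t-s)}1\,\mathrm{d}W_s$, $t\ge0$, where $e^{-\cdot t}$ denotes multiplication by $\theta\mapsto e^{-\theta t}$ and the integral is a stochastic integral in $\mathcal{H}_\mu$. The transition semigroup is $P_tf(y):=\mathbb{E}[f(Y^y_t)]$ for bounded Borel $f:\mathcal{H}_\mu\to\mathbb{R}$. It is strongly Feller at time $t>0$ if $P_tf$ is continuous for every bounded measurable $f:\mathcal{H}_\mu\to\mathbb{R}$. *)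

(* Defs.v *)
From HB Require Import structures.
From mathcomp Require Import all_boot all_order all_algebra.
From mathcomp Require Import ring_quotient.
From mathcomp Require Import all_classical all_reals all_analysis.
From mathcomp Require Import measurable_realfun normal_distribution.
Set Implicit Arguments.
Unset Strict Implicit.
Unset Printing Implicit Defensive.
Import Order.TTheory GRing.Theory Num.Theory.
Import numFieldTopology.Exports numFieldNormedType.Exports.
Local Open Scope classical_set_scope.
Local Open Scope ring_scope.

Section kernel_assumption.
Context {R : realType}.
Implicit Types (K r : R -> R) (mu : {measure set (measurableTypeR R) -> \bar R}).

Definition completely_monotone K : Prop :=
  forall (k : nat) (t : R), 0 < t ->
    derivable (derive1n k K) t 1 /\ 0 <= (-1) ^+ k * derive1n k K t.

(* Measures on [0, +oo[ are measures on R that do not charge ]-oo, 0[.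
   A Borel measure on R finite on compact sets is automatically regular. *)
Definition radon_nonneg mu : Prop :=
  mu `]-oo, 0[%classic = 0%E /\ forall A : set R, compact A -> (mu A < +oo)%E.

Definition bernstein_measure K mu : Prop :=
  radon_nonneg mu /\
  forall t : R, 0 < t ->
    (\int[mu]_(x in `[0%R, +oo[%classic) (expR (- x * t))%:E)%E = (K t)%:E.

Definition msupport mu : set R :=
  [set x | forall U : set R, open U -> U x -> (0 < mu U)%E].

(* The lower bound [min(1, x^(-1/2))] is read as 1 at [x = 0], whereas
   [0 `^ a = 0] for [a != 0] in the library. *)
Definition admissible_weight mu r : Prop :=
  [/\ (forall x y, 0 <= x -> x <= y -> r y <= r x),
      measurable_fun (`[0, +oo[%classic : set R) r,
      (forall x, 0 <= x ->
        [/\ 0 < r x, (if x == 0 then 1 else Num.min 1 (x `^ (- 2^-1))) <= r x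
          & r x <= 1])
    & (\int[mu]_(x in msupport mu) (r x)%:E < +oo)%E].

Definition atomless_on mu (B : set R) : Prop :=
  forall A : set R, measurable A -> A `<=` B -> (0 < mu A)%E ->
    exists C : set R, [/\ measurable C, C `<=` A, (0 < mu C)%E & (mu C < mu A)%E].

End kernel_assumption.

Record lifted_kernel (R : realType) := LiftedKernel {
  lift_K : R -> R ;
  lift_mu : {measure set (measurableTypeR R) -> \bar R} ;
  lift_r : R -> R ;
  lift_KP : completely_monotone lift_K ;
  lift_muP : bernstein_measure lift_K lift_mu ;
  lift_rP : admissible_weight lift_mu lift_r }.

Section space.
Context {R : realType}.
Variable D : lifted_kernel R.
Local Notation mu := (lift_mu D).
Local Notation r := (lift_r D).
Local Notation S := (msupport mu).

Definition sqnorm (f : R -> R) : \bar R :=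
  (\int[mu]_(x in S) (r x * `|f x| ^+ 2)%:E)%E.

(* Borel functions on the (closed) set [S] are represented by Borel functions
   on R, which the quotient below identifies when they agree a.e. on [S]. *)
Definition L2fun : {pred R -> R} :=
  [pred f | `[< measurable_fun setT f /\ (sqnorm f < +oo)%E >]].

Lemma open_support_compl : open (~` S).
Proof.
rewrite openE => x /=.
move=> /existsNP[U /not_implyP[oU /not_implyP[Ux mU]]].
rewrite /interior; apply: (filterS _ (open_nbhs_nbhs (conj oU Ux))).
by move=> y Uy /= Sy; apply: mU; exact: Sy.
Qed.

Lemma measurable_support : measurable (S : set (measurableTypeR R)).
Proof.
rewrite -[S]setCK; apply: measurableC.
exact: (open_measurable open_support_compl).
Qed.

Lemma support_ge0 x : S x -> 0 <= x.
Proof.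
move=> Sx; rewrite leNgt; apply/negP => x0.
have := Sx `]-oo, 0[%classic (@lray_open _ R 0).
rewrite /= in_itv/= => /(_ x0).
by have [[-> _] _] := lift_muP D; rewrite ltxx.
Qed.

Lemma weight_gt0 x : S x -> 0 < r x.
Proof. by move=> /support_ge0 x0; have [_ _ /(_ _ x0)[]] := lift_rP D. Qed.

Lemma support_sub : S `<=` `[0, +oo[%classic.
Proof. by move=> x /support_ge0 x0 /=; rewrite in_itv/= x0. Qed.

Lemma measurable_weight : measurable_fun (S : set (measurableTypeR R)) r.
Proof.
have [_ mr _ _] := lift_rP D.
by apply: measurable_funS mr => //; exact: support_sub.
Qed.

Definition wt (f : R -> R) : R -> R := (Num.sqrt \o r) \_ S \* f.

Lemma measurable_wt f : measurable_fun setT f ->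
  measurable_fun (setT : set (measurableTypeR R)) (wt f).
Proof.
move=> mf; apply: measurable_funM => //.
have [+ _] := @measurable_restrictT _ _ (measurableTypeR R) R S
  (Num.sqrt \o r) measurable_support.
apply; apply: (measurableT_comp _ measurable_weight).
exact: (continuous_measurable_fun (@sqrt_continuous R)).
Qed.

Lemma sqnormE f : sqnorm f = ('N[mu]_2[EFin \o wt f] `^ 2)%E.
Proof.
rewrite poweR_Lnorm// /sqnorm [LHS]integral_mkcond.
apply: eq_integral => x _ /=.
rewrite /wt /= !patchE; case: ifPn => [|_]; last first.
  by rewrite (_ : point = 0 :> R)// mul0r normr0 powR0.
rewrite inE => /weight_gt0 r0.
rewrite powR_mulrn// normrM exprMn (ger0_norm (sqrtr_ge0 _)).
by rewrite sqr_sqrtr// ltW.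
Qed.

Lemma L2funP f : reflect (measurable_fun setT f /\ ('N[mu]_2[EFin \o wt f] < +oo)%E)
  (f \in L2fun).
Proof.
apply: (equivP (asboolP _)); split => -[mf]; rewrite sqnormE => fy; split => //.
  exact: lty_poweRy fy.
exact: poweR_lty.
Qed.

Lemma wtD f g : wt (f + g) = wt f \+ wt g.
Proof. by apply/funext => x; rewrite /wt /= mulrDr. Qed.

Lemma wtZ a f : wt (a *: f) = a \*: wt f.
Proof. by apply/funext => x; rewrite /wt /= -scalerAr. Qed.

Lemma wtLZ (a : R) (f : R -> R) : measurable_fun setT f ->
  ('N[mu]_2[EFin \o wt (a *: f)] = `|a|%:E * 'N[mu]_2[EFin \o wt f])%E.
Proof.
move=> mf; rewrite unlock /Lnorm wtZ.
under eq_integral do rewrite /= normrM powRM// EFinM.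
rewrite ge0_integralZl//; last first.
  apply/measurable_EFinP; apply: (@measurableT_comp _ _ _ _ _ _ (@powR R ^~ 2)) => //.
  by apply: measurableT_comp => //; exact: measurable_wt.
rewrite poweRM ?integral_ge0// ?lee_fin ?powR_ge0//.
by rewrite poweR_EFin -powRrM mulfV// powRr1.
Qed.

Lemma L2fun_submod_closed : submod_closed L2fun.
Proof.
split.
  apply/L2funP; split; first exact: measurable_cst.
  rewrite (_ : EFin \o _ = cst 0%E) ?Lnorm0//.
  by apply/funext => x; rewrite /wt /= mulr0.
move=> a f g /L2funP[mf fy] /L2funP[mg gy].
have maf : measurable_fun setT (a *: f) by exact: measurable_funM.
apply/L2funP; split; first exact: measurable_funD.
rewrite wtD (le_lt_trans (minkowski_EFin _ (measurable_wt maf) (measurable_wt mg) _))//.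
  by rewrite ler1n.
by rewrite lte_add_pinfty// wtLZ// lte_mul_pinfty.
Qed.

HB.instance Definition _ := GRing.isSubmodClosed.Build R (R -> R) L2fun
  L2fun_submod_closed.

Record L2rep := L2Rep { L2val :> R -> R ; L2valP : L2val \in L2fun }.

HB.instance Definition _ := [isSub for L2val].
HB.instance Definition _ := [Choice of L2rep by <:].
HB.instance Definition _ := [SubChoice_isSubLmodule of L2rep by <:].

Definition L2null : {pred L2rep} :=
  [pred f : L2rep | `[< {ae mu, forall x, S x -> f x = 0} >]].

Lemma L2val_sub (f g : L2rep) x : (f - g) x = f x - g x.
Proof. by []. Qed.

Lemma L2val_scale (a : R) (f : L2rep) x : (a *: f) x = a * f x.
Proof. by []. Qed.

Lemma L2null_zmod_closed : zmod_closed L2null.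
Proof.
split; first by apply/asboolP/aeW.
move=> f g /asboolP f0 /asboolP g0; apply/asboolP.
apply: (@filterS2 _ _ (ae_filter_ringOfSetsType mu)) f0 g0 => x fx gx Sx.
by rewrite L2val_sub fx// gx// subr0.
Qed.

HB.instance Definition _ := GRing.isZmodClosed.Build L2rep L2null
  L2null_zmod_closed.

Definition Hmu : Type := Quotient.quot L2null.
HB.instance Definition _ := GRing.Zmodule.on Hmu.
HB.instance Definition _ := EqQuotient.on Hmu.
HB.instance Definition _ := Choice.on Hmu.

Local Open Scope quotient_scope.

Definition scaleH (a : R) (u : Hmu) : Hmu := \pi_Hmu (a *: repr u).

Lemma eqH (f g : L2rep) :
  reflect {ae mu, forall x, S x -> f x = g x} (f == g %[mod Hmu]).
Proof.
rewrite -Quotient.idealrBE; apply: (equivP (asboolP _)); split => fg.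
  by apply: (@filterS _ _ (ae_filter_ringOfSetsType mu)) fg => x fg Sx; apply/subr0_eq; rewrite -L2val_sub; exact: fg.
by apply: (@filterS _ _ (ae_filter_ringOfSetsType mu)) fg => x fg Sx; rewrite L2val_sub fg// subrr.
Qed.

Lemma pi_HZ a f : scaleH a (\pi_Hmu f) = \pi_Hmu (a *: f).
Proof.
apply/eqP/eqH.
have /eqP/eqH : repr (\pi_Hmu f) = f %[mod Hmu] by rewrite reprK.
by apply: (@filterS _ _ (ae_filter_ringOfSetsType mu)) => x fg Sx; rewrite !L2val_scale fg.
Qed.

Lemma pi_HD f g : \pi_Hmu (f + g) = \pi_Hmu f + \pi_Hmu g.
Proof. exact: Quotient.pi_add. Qed.

Lemma scaleHA a b u : scaleH a (scaleH b u) = scaleH (a * b) u.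
Proof. by elim/quotW: u => f; rewrite [scaleH b _]pi_HZ !pi_HZ scalerA. Qed.

Lemma scaleH1 : left_id 1 scaleH.
Proof. by elim/quotW => f; rewrite pi_HZ scale1r. Qed.

Lemma scaleHDr : right_distributive scaleH +%R.
Proof.
move=> a; elim/quotW => f; elim/quotW => g.
by rewrite -pi_HD !pi_HZ -pi_HD scalerDr.
Qed.

Lemma scaleHDl u : {morph scaleH^~ u : a b / a + b}.
Proof. by move=> a b; elim/quotW: u => f; rewrite !pi_HZ -pi_HD scalerDl. Qed.

HB.instance Definition _ := GRing.Zmodule_isLmodule.Build R Hmu
  scaleHA scaleH1 scaleHDr scaleHDl.

Definition normH (u : Hmu) : R := Num.sqrt (fine (sqnorm (repr u))).

Definition nm (f : R -> R) : R := Num.sqrt (fine (sqnorm f)).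

Lemma nmE (f : L2rep) : (nm f)%:E = ('N[mu]_2[EFin \o wt f])%E.
Proof.
have /L2funP[_] := L2valP f; have := Lnorm_ge0 mu 2 (EFin \o wt f).
rewrite /nm sqnormE; case: ('N[mu]_2[_])%E => // x; rewrite lee_fin => x0 _.
by rewrite poweR_EFin /= powR_mulrn// sqrtr_sqr ger0_norm.
Qed.

Lemma mL2 (f : L2rep) : measurable_fun setT f.
Proof. by have /L2funP[] := L2valP f. Qed.

Lemma nm_le (f g : L2rep) : nm (f + g : L2rep) <= nm f + nm g.
Proof.
rewrite -lee_fin EFinD !nmE (_ : wt _ = wt f \+ wt g); last exact: wtD.
by apply: minkowski_EFin; rewrite ?ler1n//; exact: (measurable_wt (mL2 _)).
Qed.

Lemma nmZ a (f : L2rep) : nm (a *: f : L2rep) = `|a| * nm f.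
Proof. by apply: EFin_inj; rewrite EFinM !nmE wtLZ//; exact: mL2. Qed.

Lemma nm_eq0 (f : L2rep) : nm f = 0 <-> {ae mu, forall x, S x -> f x = 0}.
Proof.
split => [f0|f0].
  have := Lnorm_eq0_eq0 (f := EFin \o wt f) (mu := mu) (p := 2).
  rewrite -nmE f0 => /(_ _ _ erefl)[]//.
    by apply/measurable_EFinP; exact: (measurable_wt (mL2 _)).
  move=> N [mN N0 sN]; exists N; split => // x fx; apply: sN => /= /(_ I) wf0.
  apply: fx => Sx; move: wf0 => /= [] /eqP.
  rewrite /wt /= patchE mem_set// mulf_eq0 => /orP[|/eqP//].
  by rewrite /= sqrtr_eq0 leNgt weight_gt0.
rewrite /nm /sqnorm.
rewrite (ae_eq_integral (cst 0%E)) ?integral0 ?sqrtr0//.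
- exact: measurable_support.
- apply/measurable_EFinP; apply: measurable_funM; first exact: measurable_weight.
  apply: (@measurableT_comp _ _ _ _ _ _ (fun x : R => x ^+ 2)) => //.
  apply: measurableT_comp => //.
  apply: measurable_funS (mL2 f) => //.
- apply: (@filterS _ _ (ae_filter_ringOfSetsType mu)) f0 => x f0 Sx.
  by rewrite f0// normr0 expr0n mulr0.
Qed.

Lemma nm_eq_le (f g : L2rep) : f = g %[mod Hmu] -> nm f <= nm g.
Proof.
move=> fg; have fg0 : nm (f - g : L2rep) = 0.
  apply/nm_eq0; move/eqP: fg; rewrite -Quotient.idealrBE => /asboolP.
  exact.
rewrite -[f in leLHS](subrK g); apply: (le_trans (nm_le _ _)).
by rewrite fg0 add0r.
Qed.

Lemma nm_eq (f g : L2rep) : f = g %[mod Hmu] -> nm f = nm g.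
Proof. by move=> fg; apply/eqP; rewrite eq_le !nm_eq_le. Qed.

Lemma normH_pi (f : L2rep) : normH (\pi_Hmu f) = nm f.
Proof. by apply: nm_eq; rewrite reprK. Qed.

Lemma ler_normHD u v : normH (u + v) <= normH u + normH v.
Proof.
by elim/quotW: u => f; elim/quotW: v => g; rewrite -pi_HD !normH_pi; exact: nm_le.
Qed.

Lemma normHZ (a : R) u : normH (a *: u) = `|a| * normH u.
Proof.
elim/quotW: u => f; rewrite (_ : a *: _ = \pi_Hmu (a *: f)) ?normH_pi ?nmZ//.
exact: pi_HZ.
Qed.

Lemma normH0_eq0 u : normH u = 0 -> u = 0.
Proof.
elim/quotW: u => f; rewrite normH_pi => /nm_eq0 u0.
have <- : \pi_Hmu 0 = 0 by apply: (addrI (\pi_Hmu 0)); rewrite -pi_HD !addr0.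
by apply/eqP/eqH.
Qed.

HB.instance Definition _ := @Lmodule_isNormed.Build R Hmu normH
  ler_normHD normHZ normH0_eq0.

Lemma normHE (u : Hmu) : `|u| = Num.sqrt (fine (sqnorm (repr u))).
Proof. by []. Qed.

(* Class of [f], with the convention that it is 0 when [f] is not in [L2fun]. *)
Definition toH (f : R -> R) : Hmu := \pi_Hmu (insubd (0 : L2rep) f).

Lemma toH_eq (f : R -> R) : f \in L2fun ->
  {ae mu, forall x, S x -> repr (toH f) x = f x}.
Proof.
move=> fL; have /eqP/eqH : repr (toH f) = insubd (0 : L2rep) f %[mod Hmu].
  by rewrite reprK.
apply: (@filterS _ _ (ae_filter_ringOfSetsType mu)) => x + Sx => /(_ Sx) ->.
by rewrite -[in RHS](insubdK (0 : L2rep) fL).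
Qed.

Definition oneH : Hmu := toH (cst 1).

Lemma one_L2fun : (cst 1 : R -> R) \in L2fun.
Proof.
apply/asboolP; split; first exact: measurable_cst.
have [_ _ _] := lift_rP D; congr (_ < _)%E; apply: eq_integral => x _.
by rewrite normr1 expr1n mulr1.
Qed.

Definition expH (t : R) (u : Hmu) : Hmu :=
  toH (fun x => expR (- x * t) * repr u x).

Lemma exp_L2fun (t : R) (u : Hmu) : 0 <= t ->
  (fun x => expR (- x * t) * repr u x) \in L2fun.
Proof.
move=> t0; have /asboolP[mu_ uy] := L2valP (repr u).
have me : measurable_fun setT (fun x : R => expR (- x * t) * repr u x).
  apply: measurable_funM mu_; apply: measurableT_comp => //.
  by apply: measurable_funM => //; exact: oppr_measurable.
have msq (g : R -> R) : measurable_fun setT g ->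
    measurable_fun (S : set (measurableTypeR R))
      (fun x => (r x * `|g x| ^+ 2)%:E).
  move=> mg; apply/measurable_EFinP.
  apply: measurable_funM; first exact: measurable_weight.
  apply: (@measurableT_comp _ _ _ _ _ _ (fun x : R => x ^+ 2)) => //.
  by apply: measurableT_comp => //; exact: measurable_funS mg.
apply/asboolP; split=> //; apply: le_lt_trans uy; apply: ge0_le_integral => //.
- exact: measurable_support.
- by move=> x Sx; rewrite lee_fin mulr_ge0// ltW// weight_gt0.
- exact: msq.
- exact: msq.
- move=> x Sx; rewrite lee_fin; apply: ler_wpM2l; first exact/ltW/weight_gt0.
  apply: lerXn2r; rewrite ?nnegrE// normrM ler_piMl// ger0_norm ?expR_ge0//.
  by rewrite -expR0 ler_expR mulNr oppr_le0 mulr_ge0// support_ge0.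
Qed.

End space.

Definition borel (V : ptopologicalType) := g_sigma_algebraType (@open V).

Section stochastic.
Context d (Omega : measurableType d) (R : realType) (P : probability Omega R).
Implicit Types (F : R -> set (set Omega)) (W : R -> Omega -> R).

Definition usual_filtration F : Prop :=
  [/\ measure_is_complete P,
      (forall t, 0 <= t -> sigma_algebra setT (F t) /\ F t `<=` measurable),
      (forall s t, 0 <= s -> s <= t -> F s `<=` F t),
      (forall N, P.-negligible N -> F 0 N)
    & forall t, 0 <= t -> \bigcap_(s in `]t, +oo[) F s `<=` F t].

Definition brownian_motion F W : Prop :=
  [/\ (forall t, 0 <= t -> forall B, measurable B -> F t (W t @^-1` B)),
      {ae P, forall w, W 0 w = 0},
      {ae P, forall w, {within `[0, +oo[, continuous (W ^~ w)}},
      (forall s t, 0 <= s -> s < t -> forall B, measurable B ->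
        P ((W t \- W s) @^-1` B) = normal_prob 0 (Num.sqrt (t - s)) B)
    & forall s t, 0 <= s -> s < t -> forall A B, F s A -> measurable B ->
        P (A `&` (W t \- W s) @^-1` B) = (P A * P ((W t \- W s)%R @^-1` B))%E].

Section ito.
Variable V : normedModType R.

(* The elementary process [\sum_i 1_{]a_i, b_i]} 1_{A_i} v_i]. *)
Record elementary := Elementary {
  el_size : nat ;
  el_a : 'I_el_size -> R ;
  el_b : 'I_el_size -> R ;
  el_A : 'I_el_size -> set Omega ;
  el_v : 'I_el_size -> V }.

Definition adapted F (T : R) (e : elementary) : Prop :=
  forall i : 'I_(el_size e),
    [/\ 0 <= el_a i, el_a i <= el_b i, el_b i <= T & F (el_a i) (el_A i)].

Definition el_process (e : elementary) (s : R) (w : Omega) : V :=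
  \sum_(i < el_size e) (\1_(`]el_a i, el_b i]) s * \1_(el_A i) w) *: el_v i.

Definition el_integral W (e : elementary) (w : Omega) : V :=
  \sum_(i < el_size e) (\1_(el_A i) w * (W (el_b i) w - W (el_a i) w)) *: el_v i.

Definition random_element (X : Omega -> V) : Prop :=
  measurable_fun setT (X : Omega -> borel V).

(* [X] is (a version of) the Ito integral of [Phi] over [0, T]. *)
Definition ito_integral F W (T : R) (Phi : R -> Omega -> V) (X : Omega -> V)
  : Prop :=
  [/\ (forall U : set V, open U -> measurable
        [set sw : measurableTypeR R * Omega | 0 <= sw.1 <= T /\ U (Phi sw.1 sw.2)]),
      random_element X
    & exists e : nat -> elementary,
      [/\ forall n, adapted F T (e n),
          (\int[P]_w \int[lebesgue_measure]_(s in `[0%R, T])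
             (`|el_process (e n) s w - Phi s w| ^+ 2)%:E)%E @[n --> \oo] --> 0%E
        & (\int[P]_w (`|el_integral W (e n) w - X w| ^+ 2)%:E)%E
             @[n --> \oo] --> 0%E]].

End ito.

Variable D : lifted_kernel R.

Definition mild_solution F W (y : Hmu D) (Y : R -> Omega -> Hmu D) : Prop :=
  forall t, 0 <= t -> random_element (Y t) /\
    exists2 X, ito_integral F W t (fun s _ => expH (t - s) (oneH D)) X
      & {ae P, forall w, Y t w = expH t y + X w}.

Implicit Types (Y : Hmu D -> R -> Omega -> Hmu D) (f : Hmu D -> R).

Definition transition Y (t : R) f (y : Hmu D) : R :=
  fine 'E_P[fun w => f (Y y t w)].

Definition bounded_borel f : Prop :=
  (exists M : R, forall u, `|f u| <= M) /\
  measurable_fun setT (f : borel (Hmu D) -> R).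

Definition strongly_feller_at Y (t : R) : Prop :=
  forall f, bounded_borel f -> continuous (transition Y t f).

Definition strongly_feller Y : Prop :=
  forall t, 0 < t -> strongly_feller_at Y t.

End stochastic.

(* Main.v *)
(* The mild solution is Y^y_t = e^{-.t} y + X with X the Ito integral of the
   deterministic curve s |-> e^{-.(t-s)} 1.  Since mu is atomless on B, there are
   pairwise disjoint sets A_n, A'_n in a bounded part of B, of positive measure,
   with A_n and A'_n inside a common interval of length 2^-(n+1).  Let l_n(u) be
   the difference of the mu-averages of u over A_n and A'_n.  As
   theta |-> e^{-theta s} is s-Lipschitz, |l_n(e^{-.s} 1)| <= 2^-(n+1) s, so the
   Ito isometry gives sum_n E[l_n(X)^2] < +oo, and X almost surely lies in the
   Borel linear subspace G of those u with sum_n l_n(u)^2 < +oo.  On the other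
   hand, with y = e^{.t} on the union of the A_n and y = 0 elsewhere,
   l_n(e^{-.t} y) = 1 for all n, so a e^{-.t} y + X is almost surely outside G for
   all a > 0.  Hence P_t 1_G is 1 at 0 and 0 at a y for all a > 0. *)
Require Import Defs.
From HB Require Import structures.
From mathcomp Require Import all_boot all_order all_algebra.
From mathcomp Require Import all_classical all_reals all_analysis.
From mathcomp Require Import measurable_realfun normal_distribution ring lra.
Set Implicit Arguments.
Unset Strict Implicit.
Unset Printing Implicit Defensive.
Import Order.TTheory GRing.Theory Num.Theory.
Import numFieldTopology.Exports numFieldNormedType.Exports.
Local Open Scope classical_set_scope.
Local Open Scope ring_scope.

(** * Moments of the centered normal laws *)

(** The mechanism is that one Brownian motion drives all [theta] at once: X inherits the Lipschitz
    dependence on [theta] of its integrand, while initial values may jump between neighbouring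
    [theta], and the semigroup, a multiplication operator, does not smooth such jumps. Atomlessness
    supplies disjoint sets arbitrarily close to each other; elements of [Hmu D] are classes modulo
    null sets, so averages take the place of point values. The restriction to a bounded part of B
    keeps the weight above some [r M > 0], which makes the averages bounded linear forms, and keeps
    [e^{theta t}] bounded, so that y has finite norm. Boundedness of the l_n makes G Borel and lets
    l_n pass through the approximation that defines the Ito integral: the moment estimate is proved
    for scalar simple processes and carried to the limit as an inequality. The lengths 2^-(n+1)
    serve summability. Since y involves all the A_k together, each A'_n has to be disjoint from
    every A_k, not only from A_n. *)

Section normal_moments.
Context {R : realType}.
Local Notation leb := (@lebesgue_measure R).

(** The Radon-Nikodym derivative and [normal_pdf m s] have the same integral over every measurable
    set, hence agree almost everywhere, and the change of variables for the former carries over. *)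
Lemma ge0_integral_normal_prob (m s : R) (f : R -> \bar R) :
  measurable_fun setT f -> (forall x, 0 <= f x)%E ->
  (\int[normal_prob m s]_x f x = \int[leb]_x (f x * (normal_pdf m s x)%:E))%E.
Proof.
move=> mf f0; have dom := @normal_prob_dominates R m s.
rewrite -(Radon_Nikodym_SigmaFinite.change_of_variables dom)//.
set g := Radon_Nikodym_SigmaFinite.f _ _.
have gi : leb.-integrable setT g by exact: Radon_Nikodym_SigmaFinite.f_integrable.
have mpdf : measurable_fun setT (EFin \o normal_pdf m s).
  by apply/measurable_EFinP; exact: measurable_normal_pdf.
apply: ae_eq_integral => //.
- by apply: emeasurable_funM => //; exact: measurable_int gi.
- exact: emeasurable_funM.
have : ae_eq leb setT g (EFin \o normal_pdf m s).
  apply: integral_ae_eq => //= E _ mE.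
  by rewrite -Radon_Nikodym_SigmaFinite.f_integral.
by apply: filterS => x /= + _ => /(_ Logic.I) ->.
Qed.

Lemma normal_pdf_scale (s x : R) : 0 < s ->
  normal_pdf 0 s x = s^-1 * normal_pdf 0 1 (x / s).
Proof.
move=> s0; rewrite !normal_pdfE ?gt_eqF// /normal_peak /normal_fun.
rewrite mulrA !subr0; congr (_ * expR _); last first.
  rewrite expr1n expr_div_n !mulNr; congr (- _).
  by rewrite -mulrnAl; field; rewrite gt_eqF.
rewrite expr1n mul1r -mulrnAr sqrtrM ?sqr_ge0// sqrtr_sqr gtr0_norm// invfM//.
Qed.

Lemma normal_pdfN (s x : R) : s != 0 -> normal_pdf 0 s (- x) = normal_pdf 0 s x.
Proof. by move=> s0; rewrite !normal_pdfE// /normal_fun !subr0 sqrrN. Qed.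

Lemma normal_second_moment_lty :
  (\int[normal_prob 0 1]_x (x ^+ 2)%:E < +oo :> \bar R)%E.
Proof.
(* Variance 2 is chosen so that [x ^+ 2 * exp (- x ^+ 2 / 2) <= 4 * exp (- x ^+ 2 / 4)], a
   consequence of [x ^+ 2 / 4 <= exp (x ^+ 2 / 4)]; the right side is a multiple of a density. *)
pose s : R := Num.sqrt 2.
have s0 : s != 0 by rewrite gt_eqF// sqrtr_gt0.
have m2 : measurable_fun setT (fun x : R => (x ^+ 2)%:E).
  by apply/measurable_EFinP; exact: measurable_funX.
rewrite ge0_integral_normal_prob//; last first.
  by move=> x; rewrite lee_fin sqr_ge0.
pose k : R := 4 * normal_peak 1 / normal_peak s.
have k0 : 0 <= k by rewrite !mulr_ge0 ?invr_ge0 ?normal_peak_ge0.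
apply: (@le_lt_trans _ _ (\int[leb]_x (k%:E * (normal_pdf 0 s x)%:E)))%E.
  apply: ge0_le_integral => //.
  - by move=> x _; rewrite -EFinM lee_fin mulr_ge0 ?sqr_ge0 ?normal_pdf_ge0.
  - apply: emeasurable_funM => //.
    by apply/measurable_EFinP; exact: measurable_normal_pdf.
  - apply: emeasurable_funM => //.
    by apply/measurable_EFinP; exact: measurable_normal_pdf.
  move=> x _; rewrite -!EFinM lee_fin !normal_pdfE// ?oner_eq0// /k.
  suff h : x ^+ 2 * normal_fun 0 1 x <= 4 * normal_fun 0 s x.
    rewrite [leLHS](_ : _ = normal_peak 1 * (x ^+ 2 * normal_fun 0 1 x)); last by ring.
    rewrite [leRHS](_ : _ = normal_peak 1 * (4 * normal_fun 0 s x)).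
      by rewrite ler_wpM2l ?normal_peak_ge0.
    by field; rewrite gt_eqF ?normal_peak_gt0.
  rewrite /normal_fun !subr0 expr1n /s sqr_sqrtr//.
  have -> : - x ^+ 2 / (2 *+ 2) = x ^+ 2 / 4 + - x ^+ 2 / (1 *+ 2) :> R by field.
  rewrite expRD mulrA ler_wpM2r ?expR_ge0//.
  by have := expR_ge1Dx (x ^+ 2 / 4); lra.
rewrite ge0_integralZl//=; last 2 first.
- by apply/measurable_EFinP; exact: measurable_normal_pdf.
- by move=> x _; rewrite lee_fin normal_pdf_ge0.
by rewrite integral_normal_pdf mule1 ltry.
Qed.

Lemma normal_second_momentE (s : R) : 0 < s ->
  (\int[normal_prob 0 s]_x (x ^+ 2)%:E =
   (s ^+ 2)%:E * \int[normal_prob 0 1]_x (x ^+ 2)%:E :> \bar R)%E.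
Proof.
move=> s0.
have m2 : measurable_fun setT (fun x : R => (x ^+ 2)%:E).
  by apply/measurable_EFinP; exact: measurable_funX.
have p2 (x : R) : (0 <= (x ^+ 2)%:E)%E by rewrite lee_fin sqr_ge0.
rewrite !ge0_integral_normal_prob//.
(* The substitution [x / s] is made in the integral on the right-hand side, at standard deviation
   1. *)
pose F (x : R^o) : R := x / s.
pose G (x : R) : R := x ^+ 2 * normal_pdf 0 1 x.
have F'E : F^`()%classic = cst s^-1.
  apply/funext => x; rewrite /F derive1E deriveM// derive_cst scaler0 add0r.
  by rewrite derive_id scaler1.
rewrite [X in (_ * X)%E](_ : _ = \int[leb]_x (G x)%:E)%E; last first.
  by apply: eq_integral => x _; rewrite EFinM.
rewrite (@increasing_ge0_integration_by_substitutionT _ F G) ?F'E//; last first.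
- by move=> x; rewrite /G mulr_ge0 ?sqr_ge0 ?normal_pdf_ge0.
- move=> x; apply: cvgM; first exact: sqr_continuous.
  by apply: continuous_normal_pdf; rewrite oner_eq0.
- by apply/gt0_cvgMly; [rewrite invr_gt0|exact: cvg_id].
- by apply/gt0_cvgMlNy; [rewrite invr_gt0|exact: cvg_id].
- exact: is_cvg_cst.
- exact: is_cvg_cst.
- by move=> x; exact: cvg_cst.
- by move=> x y xy; rewrite /F ltr_pM2r// invr_gt0.
rewrite -ge0_integralZl ?lee_fin ?sqr_ge0//; last 2 first.
- apply/measurable_EFinP; apply: measurable_funM => //.
  apply: measurable_funM.
    by apply: measurable_funX; apply: measurable_funM.
  apply: measurableT_comp; first exact: measurable_normal_pdf.
  exact: measurable_funM.
- move=> x _; rewrite lee_fin; apply: mulr_ge0; last by rewrite /= invr_ge0 ltW.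
  by rewrite /G /= mulr_ge0 ?sqr_ge0 ?normal_pdf_ge0.
apply: eq_integral => x _; rewrite -!EFinM normal_pdf_scale//.
congr EFin.
change (x ^+ 2 * (s^-1 * normal_pdf 0 1 (x / s)) =
  s ^+ 2 * ((x / s) ^+ 2 * normal_pdf 0 1 (x / s) * s^-1)).
by field; rewrite gt_eqF.
Qed.

Lemma normal_prob_integrable (s : R) : 0 < s ->
  (normal_prob 0 s).-integrable setT (EFin : measurableTypeR R -> \bar R).
Proof.
move=> s0; apply/integrableP; split; first by apply/measurable_EFinP.
apply: (@le_lt_trans _ _ (\int[normal_prob 0 s]_x (1 + (x ^+ 2)%:E)))%E.
  apply: ge0_le_integral => //.
  - by apply: measurableT_comp => //; apply/measurable_EFinP.
  - by apply: emeasurable_funD => //; exact/measurable_EFinP/measurable_funX.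
  move=> x _; rewrite -EFinD lee_fin ler_norml.
  have := sqr_ge0 (x + 2^-1 : R); have := sqr_ge0 (x - 2^-1 : R).
  by rewrite sqrrB sqrrD => h1 h2; apply/andP; split; lra.
rewrite ge0_integralD//; last 2 first.
- by move=> x _; rewrite lee_fin sqr_ge0.
- by apply/measurable_EFinP; exact: measurable_funX.
rewrite integral_cst//= mul1e probability_setT normal_second_momentE//.
rewrite lte_add_pinfty ?ltry// lte_mul_pinfty ?lee_fin ?sqr_ge0//.
exact: normal_second_moment_lty.
Qed.

(** The density is even, so the reflection [x |-> - x], which preserves Lebesgue measure, exchanges
    the integrals of the positive and negative parts. *)
Lemma normal_mean (s : R) : 0 < s ->
  (\int[normal_prob 0 s]_x x%:E = 0 :> \bar R)%E.
Proof.
move=> s0; have ix := normal_prob_integrable s0.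
have mE : measurable_fun setT (EFin : measurableTypeR R -> \bar R).
  by apply/measurable_EFinP.
rewrite integralE; suff <- : (\int[normal_prob 0 s]_x (EFin^\+ x) =
    \int[normal_prob 0 s]_x (EFin^\- x) :> \bar R)%E.
  by rewrite subee// integrable_pos_fin_num.
rewrite !ge0_integral_normal_prob//;
  [|exact: measurable_funeneg|exact: measurable_funepos].
set f := fun x => (_ * _)%E.
transitivity (\int[leb]_(x in (-%R : _ -> measurableTypeR R) @^-1` setT) (f \o -%R) x)%E.
  rewrite -ge0_integral_pushforward//.
  - by apply: eq_measure_integral => A mA _; exact/esym/lebesgue_measureN.
  - apply: emeasurable_funM; first exact: measurable_funepos.
    by apply/measurable_EFinP; exact: measurable_normal_pdf.
  - by move=> x _; rewrite mule_ge0// lee_fin normal_pdf_ge0.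
rewrite preimage_setT; apply: eq_integral => x _.
by rewrite /f /= normal_pdfN ?gt_eqF// funeposE funenegE EFinN.
Qed.

End normal_moments.

(** * Products of independent variables *)

Section independence.
Context d (T : measurableType d) (R : realType) (P : probability T R).

Definition indep_fun (U V : T -> R) : Prop :=
  forall B1 B2 : set R, measurable B1 -> measurable B2 ->
    P (U @^-1` B1 `&` V @^-1` B2) = (P (U @^-1` B1) * P (V @^-1` B2))%E.

Lemma indep_fun_comp (U V : T -> R) (g : R -> R) :
  measurable_fun setT g -> indep_fun U V -> indep_fun U (g \o V).
Proof.
move=> mg UV B1 B2 mB1 mB2; rewrite comp_preimage; apply: UV => //.
by rewrite -[_ @^-1` _]setTI; exact: mg.
Qed.

(** By uniqueness of the product measure, independence says that the pair has the product of the two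
    laws; Fubini then factors the integral. Integrability of the product comes from the same
    factorisation for absolute values. *)
Lemma indep_integralM (U V : T -> R) :
  P.-integrable setT (EFin \o U) -> P.-integrable setT (EFin \o V) ->
  indep_fun U V ->
  P.-integrable setT (fun w => (U w * V w)%:E) /\
  (\int[P]_w (U w * V w)%:E = \int[P]_w (U w)%:E * \int[P]_w (V w)%:E)%E.
Proof.
move=> iU iV UV.
have mU : measurable_fun setT U by apply/measurable_EFinP; exact: measurable_int iU.
have mV : measurable_fun setT V by apply/measurable_EFinP; exact: measurable_int iV.
pose X : {mfun T >-> R} := HB.pack U (isMeasurableFun.Build _ _ _ _ U mU).
pose Y : {mfun T >-> R} := HB.pack V (isMeasurableFun.Build _ _ _ _ V mV).
have mUV : measurable_fun setT (fun w => (U w, V w)) by exact: measurable_fun_pair.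
pose Z : {mfun T >-> (R * R)%type} :=
  HB.pack (fun w => (U w, V w)) (isMeasurableFun.Build _ _ _ _ _ mUV).
pose m1 := distribution P X; pose m2 := distribution P Y.
have mE : measurable_fun setT (EFin : R -> \bar R) by exact/measurable_EFinP.
have lawE A : measurable A -> (m1 \x m2)%E A = distribution P Z A.
  by apply: product_measure_unique => B1 B2 mB1 mB2; exact: UV.
pose f (z : R * R) : \bar R := (z.1 * z.2)%:E.
have mf : measurable_fun setT f.
  apply/measurable_EFinP; apply: measurable_funM.
    exact: measurable_fst.
  exact: measurable_snd.
have iX : m1.-integrable setT (EFin : R -> \bar R) by exact: integrable_pushforward.
have iY : m2.-integrable setT (EFin : R -> \bar R) by exact: integrable_pushforward.
have EX : (\int[m1]_x x%:E = \int[P]_w (U w)%:E)%E by rewrite integral_distribution.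
have EY : (\int[m2]_x x%:E = \int[P]_w (V w)%:E)%E by rewrite integral_distribution.
have fi : (m1 \x m2)%E.-integrable setT f.
  apply/integrable12ltyP => //.
  under eq_integral => x _.
    under eq_integral do rewrite /f /= normrM EFinM.
    rewrite ge0_integralZl//; last first.
      by apply/measurable_EFinP; exact: normr_measurable.
    over.
  rewrite ge0_integralZr//; last 2 first.
  - by apply/measurable_EFinP; exact: normr_measurable.
  - exact: integral_ge0.
  have /integrableP[_ hX] := iX; have /integrableP[_ hY] := iY.
  have p1 : (0 <= \int[m1]_x `|x%:E|)%E by apply: integral_ge0 => x _; exact: abse_ge0.
  by apply: lte_mul_pinfty => //; rewrite ge0_fin_numE.
have ZI : (distribution P Z).-integrable setT f.
  apply/integrableP; split=> //; have /integrableP[_] := fi.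
  rewrite (eq_measure_integral (distribution P Z))// => A mA _.
  exact: lawE.
have iUV : P.-integrable setT (f \o Z).
  apply/integrableP; split; first exact: measurableT_comp.
  have /integrableP[_] := ZI; rewrite ge0_integral_distribution//.
  exact: measurableT_comp.
split => //.
transitivity (\int[distribution P Z]_z f z)%E.
  by rewrite integral_distribution.
transitivity (\int[(m1 \x m2)%E]_z f z)%E.
  by apply: eq_measure_integral => A mA _; exact/esym/lawE.
rewrite -integral12_prod_meas1// /fubini_F /f /=.
under eq_integral => x _.
  under eq_integral do rewrite EFinM.
  rewrite integralZl//.
  over.
rewrite /= EY -EX -[in RHS](fineK (integrable_fin_num measurableT iV)).
by rewrite -integralZr//= fineK// integrable_fin_num.
Qed.

End independence.

(** * Ito isometry for elementary integrands *)

(* This is 1, but the Ito isometry is only needed up to a finite constant. *)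
Definition std_normal_variance (R : realType) : R :=
  fine (\int[normal_prob 0 1]_x (x ^+ 2)%:E).

Lemma std_normal_variance_ge0 (R : realType) : 0 <= std_normal_variance R.
Proof.
by apply: fine_ge0; apply: integral_ge0 => x _; rewrite lee_fin sqr_ge0.
Qed.

Section brownian.
Context d (Omega : measurableType d) (R : realType) (P : probability Omega R).
Variables (F : R -> set (set Omega)) (W : R -> Omega -> R).
Hypotheses (hF : usual_filtration P F) (hW : brownian_motion P F W).

(** Presents [F t] as the measurable sets of a measurable type, so that general measurability lemmas
    apply at a fixed time. *)
Lemma filtration_gen t : 0 <= t ->
  F t = (measurable : set (set (g_sigma_algebraType (F t)))).
Proof.
move=> t0; have [_ sF _ _ _] := hF; have [sa _] := sF _ t0.
by rewrite /measurable /= sigma_algebra_id.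
Qed.

Lemma filtration_measurable t A : 0 <= t -> F t A -> measurable A.
Proof. by move=> t0; have [_ sF _ _ _] := hF; have [_] := sF _ t0; exact. Qed.

Lemma filtration_le s t A : 0 <= s -> s <= t -> F s A -> F t A.
Proof. by move=> s0 st; have [_ _ mF _ _] := hF; exact: mF. Qed.

Lemma filtrationI t A B : 0 <= t -> F t A -> F t B -> F t (A `&` B).
Proof. by move=> t0; rewrite (filtration_gen t0); exact: measurableI. Qed.

Lemma filtrationU t A B : 0 <= t -> F t A -> F t B -> F t (A `|` B).
Proof. by move=> t0; rewrite (filtration_gen t0); exact: measurableU. Qed.

Lemma filtrationC t A : 0 <= t -> F t A -> F t (~` A).
Proof. by move=> t0; rewrite (filtration_gen t0); exact: measurableC. Qed.

Lemma brownian_measurable t : 0 <= t -> measurable_fun setT (W t).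
Proof.
move=> t0 _ B mB; rewrite setTI; have [aW _ _ _ _] := hW.
exact: filtration_measurable (aW _ t0 _ mB).
Qed.

Local Notation kappa := (std_normal_variance R).

Lemma brownian_incr_integral s t (f : R -> R) : 0 <= s -> s < t ->
  measurable_fun setT f ->
  (normal_prob 0 (Num.sqrt (t - s))).-integrable setT (EFin \o f) ->
  P.-integrable setT (fun w => (f (W t w - W s w))%:E) /\
  (\int[P]_w (f (W t w - W s w))%:E =
   \int[normal_prob 0 (Num.sqrt (t - s))]_x (f x)%:E)%E.
Proof.
move=> s0 st mf fi; have [_ _ _ lW _] := hW.
have t0 : 0 <= t by rewrite (le_trans s0)// ltW.
pose D : Omega -> measurableTypeR R := W t \- W s.
have mD : measurable_fun setT D.
  by apply: measurable_funB; exact: brownian_measurable.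
pose X : {mfun Omega >-> measurableTypeR R} := 
  HB.pack D (isMeasurableFun.Build _ _ _ _ D mD).
have lawE A : measurable A ->
    normal_prob 0 (Num.sqrt (t - s)) A = distribution P X A.
  by move=> mA; rewrite -lW.
have mf' : measurable_fun setT (EFin \o f) by exact/measurable_EFinP.
have iX : P.-integrable setT (fun w => (f (W t w - W s w))%:E).
  apply/integrableP; split.
    by apply: (measurableT_comp mf' mD).
  have /integrableP[_] := fi.
  rewrite (eq_measure_integral (distribution P X)); last by move=> A mA _; exact: lawE.
  rewrite ge0_integral_distribution//.
  exact: measurableT_comp.
split => //; rewrite (eq_measure_integral (distribution P X)); last first.
  by move=> A mA _; exact: lawE.
by rewrite (@integral_distribution _ _ _ _ _ P X (EFin \o f)).
Qed.

Lemma brownian_incr_mean s t : 0 <= s -> s < t ->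
  P.-integrable setT (fun w => (W t w - W s w)%:E) /\
  (\int[P]_w (W t w - W s w)%:E = 0)%E.
Proof.
move=> s0 st; have ts0 : 0 < Num.sqrt (t - s) by rewrite sqrtr_gt0 subr_gt0.
have [//||h1 h2] := @brownian_incr_integral _ _ id s0 st.
  exact: normal_prob_integrable.
by split => //; rewrite h2 normal_mean.
Qed.

Lemma brownian_incr_sqr s t : 0 <= s -> s < t ->
  P.-integrable setT (fun w => ((W t w - W s w) ^+ 2)%:E) /\
  (\int[P]_w ((W t w - W s w) ^+ 2)%:E = (kappa * (t - s))%:E)%E.
Proof.
move=> s0 st; have ts0 : 0 < Num.sqrt (t - s) by rewrite sqrtr_gt0 subr_gt0.
have k0 : (0 <= \int[normal_prob 0 1]_x (x ^+ 2)%:E :> \bar R)%E.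
  by apply: integral_ge0 => x _; rewrite lee_fin sqr_ge0.
have E : (\int[normal_prob 0 (Num.sqrt (t - s))]_x (x ^+ 2)%:E =
    (kappa * (t - s))%:E)%E.
  rewrite normal_second_momentE// sqr_sqrtr ?subr_ge0 1?ltW// mulrC EFinM.
  by rewrite fineK// ge0_fin_numE// normal_second_moment_lty.
have m2 : measurable_fun setT (fun x : R => x ^+ 2) by exact: measurable_funX.
have [//||h1 h2] := @brownian_incr_integral _ _ (fun x => x ^+ 2) s0 st.
  apply/integrableP; split; first exact/measurable_EFinP.
  under eq_integral do rewrite gee0_abs ?lee_fin ?sqr_ge0//.
  by rewrite E ltry.
by split => //; rewrite h2.
Qed.

(** [W t] agrees almost surely with [W t - W 0], whose law is prescribed when [0 < t]; at [t = 0]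
    this increment vanishes. *)
Lemma brownian_sqr_integrable t : 0 <= t ->
  P.-integrable setT (fun w => (W t w ^+ 2)%:E).
Proof.
move=> t0; have [_ W0 _ _ _] := hW.
have mW2 : measurable_fun setT (fun w => (W t w ^+ 2)%:E).
  by apply/measurable_EFinP; apply: measurable_funX; exact: brownian_measurable.
have mD : measurable_fun setT (fun w => ((W t w - W 0 w) ^+ 2)%:E).
  apply/measurable_EFinP; apply: measurable_funX; apply: measurable_funB;
  exact: brownian_measurable.
apply/integrableP; split => //.
rewrite (ae_eq_integral (fun w => `| ((W t w - W 0 w) ^+ 2)%:E |)%E) => //.
- move: t0; rewrite le_eqVlt => /predU1P[<-|t0].
    under eq_integral do rewrite subrr expr0n abse0.
    by rewrite integral0.
  by have [/integrableP[]] := brownian_incr_sqr (lexx _) t0.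
- exact: measurableT_comp.
- exact: measurableT_comp.
by apply: filterS W0 => w /= -> _; rewrite subr0.
Qed.

Lemma brownian_mul_integrable A u v : 0 <= u -> 0 <= v -> measurable A ->
  P.-integrable setT (fun w => (\1_A w * (W u w * W v w))%:E).
Proof.
move=> u0 v0 mA.
apply: (le_integrable _ _ _ (integrableD _ (brownian_sqr_integrable u0)
  (brownian_sqr_integrable v0))) => //.
  apply/measurable_EFinP; apply: measurable_funM; first exact: measurable_indic.
  by apply: measurable_funM; exact: brownian_measurable.
move=> w _; rewrite -EFinD !abse_EFin lee_fin.
rewrite [leRHS]ger0_norm ?addr_ge0 ?sqr_ge0// normrM.
rewrite (@le_trans _ _ `|W u w * W v w|)//.
  by rewrite ler_piMl// indicE; case: (w \in A); rewrite ?normr1 ?normr0.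
rewrite ler_norml; have := sqr_ge0 (W u w + W v w).
have := sqr_ge0 (W u w - W v w); rewrite sqrrB sqrrD => h1 h2.
have := sqr_ge0 (W u w); have := sqr_ge0 (W v w) => h3 h4.
by apply/andP; split; lra.
Qed.

(** Expanding increments turns the second moments needed below into combinations of these numbers,
    so the martingale property only has to be stated for them. *)
Let cov A u v : R := fine (\int[P]_w (\1_A w * (W u w * W v w))%:E).

Lemma cov_sym A u v : cov A u v = cov A v u.
Proof. by congr fine; apply: eq_integral => w _; rewrite (mulrC (W u w)). Qed.

Lemma indic_brownian_adapted A x u : 0 <= x -> x <= u -> F u A ->
  forall B, measurable B -> F u ((fun w => \1_A w * W x w) @^-1` B).
Proof.
move=> x0 xu FA B mB; have [aW _ _ _ _] := hW; have u0 := le_trans x0 xu.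
have FB := filtration_le x0 xu (aW _ x0 _ mB).
(* On [A] the product is [W x]; off [A] it is 0, so there the preimage is everything or nothing
   according to whether [B] contains 0. *)
have -> : (fun w => \1_A w * W x w) @^-1` B =
    (A `&` W x @^-1` B) `|` (~` A `&` [set _ | B 0]).
  apply/seteqP; split => w /=; rewrite indicE.
    have [wA|wA] := boolP (w \in A).
      by rewrite mul1r => BW; left; split => //; exact: set_mem.
    by rewrite mul0r => B0; right; split => //; move: wA; rewrite notin_setE.
  move=> [[Aw Bw]|[Aw B0]]; first by rewrite mem_set// mul1r.
  by rewrite memNset// mul0r.
apply: filtrationU => //; first exact: filtrationI.
apply: filtrationI => //; first exact: filtrationC.
rewrite (filtration_gen u0); have [B0|B0] := pselect (B 0).
  by rewrite (_ : [set _ | _] = setT)//; apply/seteqP; split.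
by rewrite (_ : [set _ | _] = set0)//; apply/seteqP; split.
Qed.

Lemma indic_adapted A u : 0 <= u -> F u A ->
  forall B, measurable B -> F u ((\1_A : Omega -> R) @^-1` B).
Proof.
move=> u0; rewrite (filtration_gen u0) => FA B mB; rewrite -[_ @^-1` _]setTI.
exact: (@measurable_indic _ (g_sigma_algebraType (F u)) R setT A).
Qed.

Lemma indep_incr (U : Omega -> R) s t : 0 <= s -> s < t ->
  (forall B, measurable B -> F s (U @^-1` B)) ->
  indep_fun P U (fun w => W t w - W s w).
Proof.
move=> s0 st FU B1 B2 mB1 mB2; have [_ _ _ _ iW] := hW.
by apply: iW => //; exact: FU.
Qed.

Lemma brownian_integrable t : 0 <= t -> P.-integrable setT (fun w => (W t w)%:E).
Proof.
move=> t0.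
have i1 : P.-integrable setT (fun _ => 1%E : \bar R).
  exact: finite_measure_integrable_cst.
apply: (le_integrable _ _ _ (integrableD _ i1 (brownian_sqr_integrable t0))) => //.
  by apply/measurable_EFinP; exact: brownian_measurable.
move=> w _; rewrite -EFinD !abse_EFin lee_fin.
rewrite [leRHS]ger0_norm ?addr_ge0 ?sqr_ge0// ler_norml.
have := sqr_ge0 (W t w + 2^-1); have := sqr_ge0 (W t w - 2^-1).
by rewrite sqrrB sqrrD => h1 h2; apply/andP; split; lra.
Qed.

(** The variable [\1_A * W x] is known at time [u], hence independent of the later increment, which
    has mean zero. *)
Lemma brownian_incr_orth A x u v : 0 <= x -> x <= u -> u <= v -> F u A ->
  (\int[P]_w (\1_A w * W x w * (W v w - W u w))%:E = 0)%E.
Proof.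
move=> x0 xu; have u0 := le_trans x0 xu; rewrite le_eqVlt => /predU1P[<-|uv] FA.
  by under eq_integral do rewrite subrr mulr0; rewrite integral0.
have mA := filtration_measurable u0 FA.
have [i1 E1] := brownian_incr_mean u0 uv.
have [||_ ->] := @indep_integralM _ _ _ P (fun w => \1_A w * W x w)
  (fun w => W v w - W u w) _ i1; last by rewrite E1 mule0.
  apply: (le_integrable _ _ _ (brownian_integrable x0)) => //.
    apply/measurable_EFinP; apply: measurable_funM; first exact: measurable_indic.
    exact: brownian_measurable.
  move=> w _; rewrite !abse_EFin lee_fin normrM.
  by rewrite ler_piMl// indicE; case: (w \in A); rewrite ?normr1 ?normr0.
apply: indep_incr => // B mB; exact: (indic_brownian_adapted x0 xu).
Qed.

(** Martingale property of [W], tested against [\1_A * W x]. *)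
Lemma cov_mart A x u v : 0 <= x -> x <= u -> u <= v -> F u A ->
  cov A x v = cov A x u.
Proof.
move=> x0 xu uv FA; have u0 := le_trans x0 xu; have v0 := le_trans u0 uv.
have mA := filtration_measurable u0 FA.
have h := brownian_incr_orth x0 xu uv FA.
apply/eqP; rewrite -subr_eq0; apply/eqP.
rewrite /cov -fineB ?integrable_fin_num//; try exact: brownian_mul_integrable.
rewrite -integralB//; try exact: brownian_mul_integrable.
transitivity (fine (0 : \bar R)) => //; congr fine; rewrite -h.
by apply: eq_integral => w _; rewrite /= -EFinB; congr EFin; ring.
Qed.

(** The indicator of [A] is independent of the squared increment, and in the expanded square the
    cross term [cov A u v] collapses to [cov A u u]. *)
Lemma cov_sqr A u v : 0 <= u -> u <= v -> F u A ->
  cov A v v = cov A u u + kappa * (v - u) * fine (P A).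
Proof.
move=> u0 uv FA; have v0 := le_trans u0 uv.
have mA := filtration_measurable u0 FA.
move: uv; rewrite le_eqVlt => /predU1P[<-|uv].
  by rewrite subrr mulr0 mul0r addr0.
have [i1 E1] := brownian_incr_sqr u0 uv.
have [||i2 E2] := @indep_integralM _ _ _ P \1_A
  (fun w => (W v w - W u w) ^+ 2) _ i1.
- exact: integrable_indic.
- apply: (@indep_fun_comp _ _ _ _ _ (fun w => W v w - W u w) (fun x => x ^+ 2)).
    exact: measurable_funX.
  apply: indep_incr => //; exact: indic_adapted.
have h : cov A v v - 2 * cov A u v + cov A u u = kappa * (v - u) * fine (P A).
  apply: EFin_inj; rewrite [RHS]EFinM -E1 muleC fineK ?fin_num_measure//.
  rewrite (_ : P A = \int[P]_w (\1_A w)%:E)%E; last by rewrite integral_indic// setIT.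
  rewrite -E2 /cov.
  have iW x y : 0 <= x -> 0 <= y -> _ :=
    fun x0 y0 => @brownian_mul_integrable A x y x0 y0 mA.
  rewrite EFinD EFinB EFinM !fineK ?integrable_fin_num ?iW//.
  rewrite -integralZl ?iW// -integralB ?iW//; last first.
    by apply: integrableZl => //; exact: iW.
  rewrite -integralD ?iW//; last first.
    by apply: integrableB => //; [exact: iW|apply: integrableZl => //; exact: iW].
  by apply: eq_integral => w _; rewrite /= -?EFinM -?EFinB -?EFinD; congr EFin; ring.
have := cov_mart u0 (lexx _) (ltW uv) FA; rewrite -h => ->; ring.
Qed.

(** The factor [Num.max 0 (Num.min b b' - Num.max a a')] is the length of the overlap of []a, b]]
    and []a', b']]: only the common part of two increments is correlated. This is the polarised
    isometry for two steps. *)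
Lemma brownian_incr_covariance (A A' : set Omega) a b a' b' :
  0 <= a -> a <= b -> 0 <= a' -> a' <= b' -> F a A -> F a' A' ->
  P.-integrable setT (fun w =>
    ((\1_A w * (W b w - W a w)) * (\1_A' w * (W b' w - W a' w)))%:E) /\
  (\int[P]_w ((\1_A w * (W b w - W a w)) * (\1_A' w * (W b' w - W a' w)))%:E =
   (kappa * (fine (P (A `&` A')) *
     Num.max 0 (Num.min b b' - Num.max a a')))%:E)%E.
Proof.
(* With [a <= a'] both events are known at time [a'], so the martingale identities apply to their
   intersection [C]. *)
wlog aa' : a b a' b' A A' / a <= a'.
  move=> H a0 ab a'0 ab' FA FA'.
  have /orP[aa'|aa'] := le_total a a'; first exact: H.
  have [h1 h2] := H _ _ _ _ _ _ aa' a'0 ab' a0 ab FA' FA.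
  rewrite (setIC A) (minC b) (maxC a) -h2; split; last first.
    by apply: eq_integral => w _; rewrite mulrC.
  by apply: eq_integrable h1 => // w _; rewrite mulrC.
move=> a0 ab a'0 ab' FA FA'; rewrite (max_r aa').
have b0 := le_trans a0 ab; have b'0 := le_trans a'0 ab'.
set C := A `&` A'.
have FC : F a' C by apply: filtrationI => //; exact: filtration_le FA.
have mC := filtration_measurable a'0 FC.
have iW x y : 0 <= x -> 0 <= y -> _ :=
  fun x0 y0 => @brownian_mul_integrable C x y x0 y0 mC.
have iWB x y z : 0 <= x -> 0 <= y -> 0 <= z -> P.-integrable setT
    (fun w => (\1_C w * (W x w * W y w))%:E - (\1_C w * (W x w * W z w))%:E)%E.
  by move=> *; apply: integrableB => //; exact: iW.
have E w : ((\1_A w * (W b w - W a w)) * (\1_A' w * (W b' w - W a' w)))%:E =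
    (((\1_C w * (W b w * W b' w))%:E - (\1_C w * (W b w * W a' w))%:E) -
    ((\1_C w * (W a w * W b' w))%:E - (\1_C w * (W a w * W a' w))%:E))%E.
  by rewrite /C indicI /= -!EFinB; congr EFin; ring.
split.
  apply: (eq_integrable _ _ _ _ (integrableB _ (iWB b b' a' _ _ _)
    (iWB a b' a' _ _ _))) => //.
under eq_integral do rewrite E.
rewrite integralB ?iWB// !integralB ?iW//.
have covE x y : 0 <= x -> 0 <= y ->
    (\int[P]_w (\1_C w * (W x w * W y w))%:E)%E = (cov C x y)%:E.
  by move=> x0 y0; rewrite fineK// integrable_fin_num//; exact: iW.
rewrite !covE// -!EFinB; congr EFin.
(* [W a] precedes the second increment and is orthogonal to it on [C]; only
   [cov C b b' - cov C b a'] survives. *)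
rewrite [cov C a b'](cov_mart a0 aa' ab' FC) subrr subr0.
have [ba'|a'b] := ltP b a'.
  rewrite [cov C b b'](cov_mart b0 (ltW ba') ab' FC) subrr.
  by rewrite max_l ?mulr0// subr_le0 ge_min (ltW ba').
rewrite [cov C b a']cov_sym [cov C a' b](cov_mart a'0 (lexx _) a'b FC).
have a'm : a' <= Num.min b b' by rewrite le_min a'b.
(* By the martingale property the later of [b] and [b'] may be lowered to the earlier one. *)
have -> : cov C b b' = cov C (Num.min b b') (Num.min b b').
  have Fm x : a' <= x -> F x C by move=> ?; exact: filtration_le FC.
  have [bb'|/ltW b'b] := leP b b'; first exact: (cov_mart b0 (lexx _) bb' (Fm _ a'b)).
  by rewrite cov_sym; exact: (cov_mart b'0 (lexx _) b'b (Fm _ ab')).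
by rewrite (cov_sqr a'0 a'm FC) max_r ?subr_ge0//; ring.
Qed.

(** * From covariances of steps to the isometry for scalar simple processes *)

Section simple_isometry.
Variables (n : nat) (a b : 'I_n -> R) (A : 'I_n -> set Omega) (c : 'I_n -> R).
Variable T : R.
Hypothesis adA : forall i, [/\ 0 <= a i, a i <= b i, b i <= T & F (a i) (A i)].

(** The common value of both sides of the isometry, up to the factor [kappa]: a quadratic form in
    the coefficients [c]. *)
Let q : R := \sum_(i < n) \sum_(j < n) c i * c j * (fine (P (A i `&` A j)) *
  Num.max 0 (Num.min (b i) (b j) - Num.max (a i) (a j))).

Let mA i : measurable (A i).
Proof. by have [a0 _ _] := adA i; exact: filtration_measurable. Qed.

Lemma simple_ito_sqr :
  (\int[P]_w ((\sum_(i < n) (\1_(A i) w * (W (b i) w - W (a i) w)) * c i) ^+ 2)%:E =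
   (kappa * q)%:E)%E.
Proof.
pose g i j w : \bar R := ((c i * c j)%:E * ((\1_(A i) w * (W (b i) w - W (a i) w)) *
  (\1_(A j) w * (W (b j) w - W (a j) w)))%:E)%E.
have gi i j : P.-integrable setT (g i j).
  have [a0 ab bT FA] := adA i; have [a0' ab' bT' FA'] := adA j.
  apply: integrableZl => //.
  by have [] := brownian_incr_covariance a0 ab a0' ab' FA FA'.
transitivity (\int[P]_w (\sum_(i < n) \sum_(j < n) g i j w))%E.
  apply: eq_integral => w _; rewrite expr2 big_distrlr /= -sumEFin.
  apply: eq_bigr => i _; rewrite -sumEFin; apply: eq_bigr => j _.
  by rewrite /g -EFinM; congr EFin; ring.
rewrite integral_sum//; last by move=> i; apply: integrable_sum.
rewrite /q mulr_sumr -sumEFin; apply: eq_bigr => i _.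
rewrite integral_sum// mulr_sumr -sumEFin; apply: eq_bigr => j _.
have [a0 ab bT FA] := adA i; have [a0' ab' bT' FA'] := adA j.
have [h1 h2] := brownian_incr_covariance a0 ab a0' ab' FA FA'.
by rewrite integralZl// h2 -EFinM; congr EFin; ring.
Qed.

(** Holds path by path: products of indicators of intervals integrate to the lengths of the
    overlaps. The closed form later also yields measurability in [w]. *)
Lemma simple_inner_sqr w :
  (\int[lebesgue_measure]_(s in `[0%R, T])
    ((\sum_(i < n) (\1_(`]a i, b i]) s * \1_(A i) w) * c i) ^+ 2)%:E =
  (\sum_(i < n) \sum_(j < n) c i * c j * (\1_(A i `&` A j) w *
    Num.max 0 (Num.min (b i) (b j) - Num.max (a i) (a j))))%:E)%E.
Proof.
pose J i j : set R := `]a i, b i] `&` `]a j, b j].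
have mJ i j : measurable (J i j) by exact: measurableI.
pose g i j s : \bar R :=
  ((c i * c j * \1_(A i `&` A j) w)%:E * (\1_(J i j) s)%:E)%E.
have Ji i j : lebesgue_measure.-integrable `[0, T] (fun s : R => (\1_(J i j) s)%:E).
  apply/integrableP; split.
    by apply/measurable_EFinP; apply: measurable_indic; exact: mJ.
  under eq_integral do rewrite gee0_abs ?lee_fin//.
  rewrite integral_indic//; last exact: mJ.
  apply: (@le_lt_trans _ _ (lebesgue_measure (`[0, T] : set R))).
    have mJT : measurable (J i j `&` `[0, T]) by apply: measurableI => //; exact: mJ.
    by apply: le_measure; rewrite ?inE//; exact: subIsetr.
  by rewrite lebesgue_measure_itv /=; case: ifP => _; rewrite ltry.
have gi : forall k l, lebesgue_measure.-integrable `[0, T] (g k l).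
  by move=> k l; apply: integrableZl => //; exact: Ji.
transitivity (\int[lebesgue_measure]_(s in `[0%R, T])
    (\sum_(i < n) \sum_(j < n) g i j s))%E.
  apply: eq_integral => s _; rewrite expr2 big_distrlr /= -sumEFin.
  apply: eq_bigr => i _; rewrite -sumEFin; apply: eq_bigr => j _.
  by rewrite /g -EFinM /J !indicI /=; congr EFin; ring.
rewrite integral_sum//; last by move=> i; apply: integrable_sum.
rewrite -sumEFin; apply: eq_bigr => i _.
rewrite integral_sum// -sumEFin; apply: eq_bigr => j _.
rewrite integralZl ?integral_indic//; last (first [exact: mJ|exact: Ji]).
have [a0 ab bT FA] := adA i; have [a0' ab' bT' FA'] := adA j.
have -> : J i j `&` `[0, T]%classic = `]Num.max (a i) (a j), Num.min (b i) (b j)]%classic.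
  apply/seteqP; split => s; rewrite /J /= !in_itv/= gt_max le_min.
    by move=> [[/andP[-> ->] /andP[-> ->]]].
  move=> /andP[/andP[h1 h2] /andP[h3 h4]]; rewrite h1 h2 h3 h4; split=> //.
  by rewrite (le_trans a0 (ltW h1)) (le_trans h3).
rewrite /= lebesgue_measure_itv /= lte_fin.
have [h|h] := ltP (Num.max (a i) (a j)) (Num.min (b i) (b j)).
  rewrite (@max_r _ _ 0) ?subr_ge0 ?ltW//.
  transitivity ((c i * c j * \1_(A i `&` A j) w *
    (Num.min (b i) (b j) - Num.max (a i) (a j)))%:E) => //.
  by congr EFin; ring.
by rewrite (@max_l _ _ 0) ?subr_le0// mule0 !mulr0.
Qed.

Lemma simple_process_sqr :
  (\int[P]_w \int[lebesgue_measure]_(s in `[0%R, T])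
    ((\sum_(i < n) (\1_(`]a i, b i]) s * \1_(A i) w) * c i) ^+ 2)%:E = q%:E)%E.
Proof.
under eq_integral do rewrite simple_inner_sqr.
pose g i j w : \bar R := ((c i * c j *
    Num.max 0 (Num.min (b i) (b j) - Num.max (a i) (a j)))%:E *
  (\1_(A i `&` A j) w)%:E)%E.
have iA i j : P.-integrable setT (fun w => (\1_(A i `&` A j) w)%:E).
  by apply: integrable_indic => //; exact: measurableI.
have gi i j : P.-integrable setT (g i j) by exact: integrableZl.
transitivity (\int[P]_w (\sum_(i < n) \sum_(j < n) g i j w))%E.
  apply: eq_integral => w _; rewrite -sumEFin.
  apply: eq_bigr => i _; rewrite -sumEFin; apply: eq_bigr => j _.
  by rewrite /g -EFinM; congr EFin; ring.
rewrite integral_sum//; last by move=> i; apply: integrable_sum.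
rewrite /q -sumEFin; apply: eq_bigr => i _.
rewrite integral_sum// -sumEFin; apply: eq_bigr => j _.
have mAA : measurable (A i `&` A j) by exact: measurableI.
rewrite integralZl// integral_indic// setIT.
transitivity ((c i * c j * Num.max 0 (Num.min (b i) (b j) - Num.max (a i) (a j)))%:E
    * (fine (P (A i `&` A j)))%:E)%E.
  by congr (_ * _)%E; rewrite fineK// fin_num_measure.
by rewrite -EFinM; congr EFin; ring.
Qed.

Lemma simple_ito_isometry :
  (\int[P]_w ((\sum_(i < n) (\1_(A i) w * (W (b i) w - W (a i) w)) * c i) ^+ 2)%:E =
   kappa%:E * \int[P]_w \int[lebesgue_measure]_(s in `[0%R, T])
    ((\sum_(i < n) (\1_(`]a i, b i]) s * \1_(A i) w) * c i) ^+ 2)%:E)%E.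
Proof. by rewrite simple_ito_sqr simple_process_sqr. Qed.

End simple_isometry.

End brownian.

(** * Continuous functionals of Ito integrals *)

Section lower_integral.
Context d (T : measurableType d) (R : realType).
Variable mu : {measure set T -> \bar R}.
Import HBNNSimple.

(* The integral of a nonnegative function is a supremum over the simple
   functions below it, so it is monotone without any measurability. *)
Lemma ge0_integral_mono (D : set T) (f g : T -> \bar R) :
  (forall x, D x -> 0 <= f x)%E -> (forall x, D x -> f x <= g x)%E ->
  (\int[mu]_(x in D) f x <= \int[mu]_(x in D) g x)%E.
Proof.
move=> f0 fg; have g0 x : D x -> (0 <= g x)%E.
  by move=> Dx; exact: le_trans (f0 _ Dx) (fg _ Dx).
rewrite !ge0_integralE//; apply: le_ereal_sup => _ [h hf <-].
by exists h => // x; apply: le_trans (hf x) _; exact: lee_restrict.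
Qed.

(** No measurability is asked of [g], which will be built from squared norms of [V]-valued
    differences. The function [h = Num.max 0 ((f - c) / k)] is measurable, lies below [g] and
    satisfies [f <= k * h + c], so linearity of the integral is needed for [h] only. *)
Lemma integral_le_affine (D : set T) (k : R) (f c : T -> R) (g : T -> \bar R) :
  measurable D -> 0 < k -> measurable_fun D f -> measurable_fun D c ->
  (forall x, D x -> 0 <= f x) -> (forall x, D x -> 0 <= c x) ->
  (forall x, D x -> 0 <= g x)%E ->
  (forall x, D x -> (f x)%:E <= k%:E * g x + (c x)%:E)%E ->
  (\int[mu]_(x in D) (f x)%:E <=
   k%:E * \int[mu]_(x in D) g x + \int[mu]_(x in D) (c x)%:E)%E.
Proof.
move=> mD k0 mf mc f0 c0 g0 fg.
pose h x : R := Num.max 0 ((f x - c x) / k).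
have mh : measurable_fun D h.
  apply: (@measurable_maxr _ _ _ D (cst 0) (fun x => (f x - c x) / k)) => //.
  apply: (@measurable_funM _ _ _ D (f \- c) (cst k^-1)) => //.
  exact: measurable_funB.
have h0 x : 0 <= h x by rewrite /h le_max lexx.
have hg x : D x -> ((h x)%:E <= g x)%E.
  move=> Dx; have := fg x Dx; have := g0 x Dx.
  case: (g x) => [y||]//; last by move=> *; exact: leey.
  rewrite -EFinM -EFinD !lee_fin => y0 fy.
  by rewrite /h ge_max y0 ler_pdivrMr// lerBlDr mulrC.
apply: (@le_trans _ _ (\int[mu]_(x in D) (k%:E * (h x)%:E + (c x)%:E)))%E.
  apply: ge0_integral_mono => [x /f0|x Dx]; first by rewrite lee_fin.
  rewrite -EFinM -EFinD lee_fin -lerBlDr mulrC -ler_pdivrMr//.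
  by rewrite /h le_max lexx orbT.
have mhE : measurable_fun D (EFin \o h) by exact/measurable_EFinP.
have mcE : measurable_fun D (EFin \o c) by exact/measurable_EFinP.
have mkh : measurable_fun D (fun x => k%:E * (h x)%:E)%E.
  by apply/measurable_EFinP; exact: measurable_funM.
have kh0 x : D x -> (0 <= k%:E * (h x)%:E)%E.
  by move=> _; rewrite -EFinM lee_fin mulr_ge0// ltW.
have cE0 x : D x -> (0 <= (c x)%:E)%E by move=> /c0; rewrite lee_fin.
have hE0 x : D x -> (0 <= (h x)%:E)%E by rewrite lee_fin.
have k0w := ltW k0; rewrite ge0_integralD//; apply: leeD2r.
rewrite ge0_integralZl ?lee_fin//.
apply: lee_wpmul2l; first by rewrite lee_fin.
by apply: ge0_integral_mono => // x _; rewrite lee_fin.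
Qed.

End lower_integral.

Lemma scalar_borel_measurable (R : realType) (V : normedModType R)
  (l : {scalar V}) (C : R) :
  (forall v, `|l v| <= C * `|v|) -> measurable_fun setT (l : borel V -> R).
Proof.
move=> lC; have cl : continuous (l : V -> R).
  apply: bounded_linear_continuous; apply/linear_boundedP.
  apply: (filterS _ (nbhs_pinfty_ge (num_real C))) => r Cr x.
  by apply: le_trans (lC x) _; rewrite ler_wpM2r.
apply: (measurability _ (@RGenOpens.measurableE R)) => _ [_ [a [b ->]] <-].
rewrite setTI; apply: sub_sigma_algebra.
by move/continuousP: cl; apply; exact: interval_open.
Qed.

Section ito_functional.
Context d (Omega : measurableType d) (R : realType) (P : probability Omega R).
Variables (F : R -> set (set Omega)) (W : R -> Omega -> R).
Hypotheses (hF : usual_filtration P F) (hW : brownian_motion P F W).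
Variables (V : normedModType R) (l : {scalar V}) (C : R).
Hypothesis C0 : 0 < C.
Hypothesis lC : forall v, `|l v| <= C * `|v|.
Local Notation kappa := (std_normal_variance R).

Let sqr_split (x y : R) : x ^+ 2 <= 2 * (y - x) ^+ 2 + 2 * y ^+ 2.
Proof. by have := sqr_ge0 (x - 2 * y); rewrite !sqrrB; lra. Qed.

Let sqr_scalar v : l v ^+ 2 <= C ^+ 2 * `|v| ^+ 2.
Proof.
rewrite -exprMn -[leLHS](real_normK (num_real _)) ler_pXn2r ?nnegrE//.
by rewrite mulr_ge0// ltW.
Qed.

(** [l] commutes with finite sums, so the scalar isometry applies to the image under [l] of each
    elementary approximation. The factor 4 comes from two uses of [sqr_split]: from [X] to the
    elementary integral, and from the elementary process to [Phi]. Both errors are controlled by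
    [C ^+ 2] times quantities tending to 0. *)
Lemma ito_functional_sqr_le (T k : R) (Phi : R -> Omega -> V) (X : Omega -> V) :
  0 <= T -> (forall s w, 0 <= s <= T -> `|l (Phi s w)| <= k) ->
  ito_integral P F W T Phi X ->
  (\int[P]_w (l (X w) ^+ 2)%:E <= (4 * kappa * k ^+ 2 * T)%:E)%E.
Proof.
move=> T0 lk [_ rX [e [ade cvp cvi]]].
have mlX : measurable_fun setT (fun w => l (X w)).
  exact: (measurableT_comp (scalar_borel_measurable lC) rX).
pose Q n : \bar R := (\int[P]_w \int[lebesgue_measure]_(s in `[0%R, T])
  (l (el_process (e n) s w) ^+ 2)%:E)%E.
have lI n w : l (el_integral W (e n) w) = \sum_(i < el_size (e n))
    (\1_(el_A i) w * (W (el_b i) w - W (el_a i) w)) * l (el_v i).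
  by rewrite linear_sum; apply: eq_bigr => i _; rewrite linearZ.
have lp n s w : l (el_process (e n) s w) = \sum_(i < el_size (e n))
    (\1_(`]el_a i, el_b i]) s * \1_(el_A i) w) * l (el_v i).
  by rewrite linear_sum; apply: eq_bigr => i _; rewrite linearZ.
have mI n : measurable_fun setT (fun w => l (el_integral W (e n) w)).
  under eq_fun do rewrite lI.
  apply: measurable_sum => i; have [a0 ab bT FA] := ade n i.
  have b0 := le_trans a0 ab.
  apply: measurable_funM => //; apply: measurable_funM.
    by apply: measurable_indic; exact: (filtration_measurable hF a0 FA).
  by apply: measurable_funB; exact: (brownian_measurable hF hW).
have mp n w : measurable_fun (`[0%R, T]%classic : set R)
    (fun s => l (el_process (e n) s w)).
  rewrite (funext (fun s => lp n s w)).
  by apply: measurable_sum => i; do 2 apply: measurable_funM => //.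
have iso n : (\int[P]_w (l (el_integral W (e n) w) ^+ 2)%:E = kappa%:E * Q n)%E.
  rewrite /Q; under eq_integral do rewrite lI.
  under [in RHS]eq_integral do under eq_integral do rewrite lp.
  exact: (simple_ito_isometry hF hW _ (ade n)).
pose al n := (\int[P]_w \int[lebesgue_measure]_(s in `[0%R, T])
  (`|el_process (e n) s w - Phi s w| ^+ 2)%:E)%E.
pose be n := (\int[P]_w (`|el_integral W (e n) w - X w| ^+ 2)%:E)%E.
have k0 : 0 < 2 * C ^+ 2 by rewrite mulr_gt0// exprn_gt0.
have Qle n : (Q n <= (2 * C ^+ 2)%:E * al n + (2 * k ^+ 2 * T)%:E)%E.
  (* The closed form [J] of the inner integral supplies the measurability in [w] that the comparison
     of the outer integrals asks for. *)
  pose J w : R := \sum_(i < el_size (e n)) \sum_(j < el_size (e n))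
    l (el_v i) * l (el_v j) * (\1_(el_A i `&` el_A j) w *
    Num.max 0 (Num.min (el_b i) (el_b j) - Num.max (el_a i) (el_a j))).
  have JE w : (\int[lebesgue_measure]_(s in `[0%R, T])
      (l (el_process (e n) s w) ^+ 2)%:E = (J w)%:E)%E.
    under eq_integral do rewrite lp.
    exact: (simple_inner_sqr _ (ade n)).
  have mJ : measurable_fun setT J.
    apply: measurable_sum => i; apply: measurable_sum => j.
    have [a0 _ _ FA] := ade n i; have [a0' _ _ FA'] := ade n j.
    apply: measurable_funM => //; apply: measurable_funM => //.
    apply: measurable_indic; apply: measurableI.
      exact: (filtration_measurable hF a0 FA).
    exact: (filtration_measurable hF a0' FA').
  have le0T : (lebesgue_measure (`[0%R, T]%classic : set R) = T%:E)%E.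
    rewrite lebesgue_measure_itv /= lte_fin; case: ltP => [_|T0'].
      by rewrite sube0.
    by congr EFin; apply/eqP; rewrite eq_le T0.
  rewrite /Q; under eq_integral do rewrite JE.
  rewrite (_ : (2 * k ^+ 2 * T)%:E = \int[P]_w (cst (2 * k ^+ 2 * T) w)%:E)%E; last first.
    rewrite -[RHS]/(\int[P]_w cst (2 * k ^+ 2 * T)%:E w)%E integral_cst//=.
    by rewrite probability_setT mule1.
  have J0 w : 0 <= J w.
    by rewrite -lee_fin -JE integral_ge0// => s _; rewrite lee_fin sqr_ge0.
  apply: integral_le_affine => //.
  - by move=> w _; rewrite /= mulr_ge0// mulr_ge0// sqr_ge0.
  - by move=> w _; apply: integral_ge0 => s _; rewrite /= lee_fin exprn_ge0.
  move=> w _; rewrite -JE.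
  rewrite (_ : (cst (2 * k ^+ 2 * T) w)%:E = \int[lebesgue_measure]_(s in `[0%R, T])
      (cst (2 * k ^+ 2) s)%:E)%E; last first.
    rewrite -[RHS]/(\int[lebesgue_measure]_(s in `[0%R, T])
      cst (2 * k ^+ 2)%:E s)%E.
    by rewrite integral_cst//= le0T -EFinM.
  apply: integral_le_affine => //.
  - by apply: measurable_funX; exact: mp.
  - by move=> s _; rewrite sqr_ge0.
  - by move=> s _; apply: mulr_ge0 => //; exact: sqr_ge0.
  move=> s; rewrite /= in_itv/= => sT; rewrite -EFinM -EFinD lee_fin.
  apply: (le_trans (sqr_split _ (l (Phi s w)))); apply: lerD.
    rewrite -mulrA ler_pM2l// -sqrrN opprB -linearB; exact: sqr_scalar.
  rewrite ler_pM2l// -[leLHS](real_normK (num_real _)) ler_pXn2r ?nnegrE ?lk//.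
  exact: le_trans (normr_ge0 _) (lk _ w sT).
have key n : (\int[P]_w (l (X w) ^+ 2)%:E <= (2 * C ^+ 2)%:E * be n +
    (2 * kappa)%:E * ((2 * C ^+ 2)%:E * al n + (2 * k ^+ 2 * T)%:E))%E.
  apply: (@le_trans _ _ ((2 * C ^+ 2)%:E * be n + (2 * kappa)%:E * Q n))%E; last first.
    apply: leeD2l; apply: lee_wpmul2l; last exact: Qle.
    by rewrite lee_fin mulr_ge0// std_normal_variance_ge0.
  have mI2 : measurable_fun setT (fun w => l (el_integral W (e n) w) ^+ 2).
    by apply: measurable_funX; exact: mI.
  have mI2E : measurable_fun setT (fun w => (l (el_integral W (e n) w) ^+ 2)%:E).
    exact/measurable_EFinP.
  have I20 w : setT w -> (0 <= (l (el_integral W (e n) w) ^+ 2)%:E)%E.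
    by rewrite lee_fin sqr_ge0.
  have -> : ((2 * kappa)%:E * Q n =
      \int[P]_w (2 * l (el_integral W (e n) w) ^+ 2)%:E)%E.
    rewrite (EFinM 2 kappa) -muleA -iso -ge0_integralZl ?lee_fin//.
  apply: integral_le_affine => //.
  - exact: measurable_funX.
  - exact: measurable_funM.
  - by move=> w _; rewrite sqr_ge0.
  - by move=> w _; apply: mulr_ge0 => //; exact: sqr_ge0.
  move=> w _; rewrite -EFinM -EFinD lee_fin.
  apply: (le_trans (sqr_split _ (l (el_integral W (e n) w)))); rewrite lerD2r.
  by rewrite -mulrA ler_pM2l// -linearB; exact: sqr_scalar.
have cv : ((2 * C ^+ 2)%:E * be n + (2 * kappa)%:E *
    ((2 * C ^+ 2)%:E * al n + (2 * k ^+ 2 * T)%:E) @[n --> \oo] -->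
    (2 * C ^+ 2)%:E * 0 + (2 * kappa)%:E *
    ((2 * C ^+ 2)%:E * 0 + (2 * k ^+ 2 * T)%:E))%E.
  apply: cvgeD; first by rewrite !mule0 !add0e.
    by apply: cvgeZl => //; exact: cvi.
  apply: cvgeZl => //; apply: cvgeD; first by rewrite mule0.
    by apply: cvgeZl => //; exact: cvp.
  exact: cvg_cst.
rewrite !mule0 !add0e -EFinM in cv.
rewrite (_ : 4 * kappa * k ^+ 2 * T = 2 * kappa * (2 * k ^+ 2 * T)); last by ring.
rewrite -(cvg_lim _ cv)//; apply: lime_ge; first by apply/cvg_ex; eexists; exact: cv.
by apply: nearW => n; exact: key.
Qed.

End ito_functional.

(** * Disjoint pieces of an atomless set *)

(** Otherwise [A] would be a countable union of null sets. *)
Lemma cover_gt0 d (T : measurableType d) (R : realType)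
    (mu : {measure set T -> \bar R}) (A : set T) (I : nat -> set T) :
  measurable A -> (forall n, measurable (I n)) -> A `<=` \bigcup_n I n ->
  (0 < mu A)%E -> exists n, (0 < mu (A `&` I n))%E.
Proof.
move=> mA mI AI A0; apply: contrapT => /forallNP h.
have : mu.-negligible A.
  rewrite -(setIidl AI) setI_bigcupr; apply: negligible_bigcup => n.
  apply/negligibleP; first exact: measurableI.
  by apply/eqP; rewrite eq_le measure_ge0 andbT leNgt; exact/negP/h.
by move=> /negligibleP => /(_ mA) A00; move: A0; rewrite A00 ltxx.
Qed.

Section slabs.
Context {R : realType} (D : lifted_kernel R) (B : set R) (M : R).
Local Notation mu := (lift_mu D).
Local Notation S := (msupport mu).
Hypotheses (BS : B `<=` S) (aB : atomless_on mu B).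

(** Inclusion in [[0, M]] makes the measure finite and bounds the weight below by its value at [M];
    positive measure permits averaging. *)
Definition slab (A : set R) : Prop :=
  [/\ measurable A, A `<=` B, A `<=` `[0, M] & (0 < mu A)%E].

Lemma slab_lty A : slab A -> (mu A < +oo)%E.
Proof.
move=> [mA _ AM _]; have [[_ rad] _] := lift_muP D.
apply: (@le_lt_trans _ _ (mu `[0, M]%classic)); last exact/rad/segment_compact.
by apply: le_measure; rewrite ?inE.
Qed.

Lemma slab_cover (A : set R) (I : nat -> set R) : slab A ->
  (forall n, measurable (I n)) -> A `<=` \bigcup_n I n ->
  exists n, slab (A `&` I n).
Proof.
move=> [mA AB AM A0] mI AI; have [n n0] := @cover_gt0 _ _ _ mu A I mA mI AI A0.
exists n; split => //; first by apply: measurableI => //; exact: mI.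
  by move=> x [/AB].
by move=> x [/AM].
Qed.

(** Because [mu A] is finite, the strict inequality [mu C < mu A] provided by atomlessness leaves
    positive measure outside [C]. *)
Lemma slab_split A : slab A -> exists A1 A2,
  [/\ slab A1, slab A2, A1 `<=` A, A2 `<=` A & A1 `&` A2 = set0].
Proof.
move=> sA; have [mA AB AM A0] := sA; have Aoo := slab_lty sA.
have [C [mC CA C0 CltA]] := aB mA AB A0.
exists C, (A `\` C); split => //.
- by split => //; [exact: subset_trans CA AB|exact: subset_trans CA AM].
- split; [exact: measurableD|by move=> x []/AB|by move=> x []/AM|].
  rewrite measureD// (setIidr CA) sube_gt0//.
- by rewrite setDE setIA setIAC setICr set0I.
Qed.

Lemma slab_narrow A (e : R) : slab A -> 0 < e ->
  exists a A', [/\ 0 <= a, slab A', A' `<=` A & A' `<=` `[a, a + e]].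
Proof.
move=> sA e0; have [mA AB AM A0] := sA.
have [||n sAn] := @slab_cover A (fun n => `[n%:R * e, n%:R * e + e]%classic) sA => //.
  move=> x Ax; have := AM _ Ax; rewrite /= in_itv/= => /andP[x0 _].
  (* The index of the cell containing [x] in the grid of mesh [e]. *)
  exists (Num.truncn (x / e)) => //=; rewrite in_itv/=.
  have /Num.Theory.truncn_itv/andP[h1 h2] : 0 <= x / e by rewrite divr_ge0// ltW.
  rewrite -ler_pdivlMr// h1/= (_ : _ + e = (Num.truncn (x / e)).+1%:R * e).
    by rewrite -ler_pdivrMr// ltW.
  by rewrite -natr1 mulrDl mul1r.
exists (n%:R * e), (A `&` `[n%:R * e, n%:R * e + e]); split => //.
  by rewrite mulr_ge0// ltW.
Qed.

(** [A'] is a reserve kept for all later stages; the pair [C], [C'] is cut out of a narrow piece of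
    the remaining part, hence misses the reserve. *)
Lemma slab_step A (e : R) : slab A -> 0 < e -> exists t : set R * set R * set R * R,
  let: (A', C, C', a) := t in
  [/\ [/\ slab A', slab C & slab C'], [/\ A' `<=` A, C `<=` A & C' `<=` A],
    [/\ A' `&` C = set0, A' `&` C' = set0 & C `&` C' = set0] & 
    [/\ 0 <= a, C `<=` `[a, a + e] & C' `<=` `[a, a + e]]].
Proof.
move=> sA e0; have [A1 [A2 [s1 s2 A1A A2A A12]]] := slab_split sA.
have [a [A3 [a0 s3 A32 A3a]]] := slab_narrow s2 e0.
have [C [C' [sC sC' CA3 C'A3 CC']]] := slab_split s3.
exists (A1, C, C', a); split; split => //.
- by move=> x /CA3/A32/A2A.
- by move=> x /C'A3/A32/A2A.
- by apply/seteqP; split => // x [A1x /CA3/A32 A2x]; rewrite -A12.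
- by apply/seteqP; split => // x [A1x /C'A3/A32 A2x]; rewrite -A12.
- by move=> x /CA3/A3a.
- by move=> x /C'A3/A3a.
Qed.

Lemma slab_sequence (A0 : set R) (e : nat -> R) : slab A0 -> (forall n, 0 < e n) ->
  exists (C C' : nat -> set R) (a : nat -> R),
  [/\ forall n, [/\ slab (C n), slab (C' n), 0 <= a n,
        C n `<=` `[a n, a n + e n] & C' n `<=` `[a n, a n + e n]]
    & forall n m, C' n `&` C m = set0].
Proof.
move=> sA0 e0.
have step n (A : {A | slab A}) := cid (slab_step (proj2_sig A) (e0 n)).
have next n A : slab (projT1 (step n A)).1.1.1.
  by case: (step n A) => -[[[A' C] C'] a] /= [[]].
(* The recursion carries the proof that the current reserve is a slab, which the next stage
   consumes. *)
pose A := fix A n : {A | slab A} :=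
  if n is m.+1 then exist _ _ (next m (A m)) else exist _ A0 sA0.
pose t n := projT1 (step n (A n)).
have tP n := projT2 (step n (A n)).
exists (fun n => (t n).1.1.2), (fun n => (t n).1.2), (fun n => (t n).2).
have AS n : proj1_sig (A n.+1) = (t n).1.1.1 by [].
have Adec n m : (n <= m)%N -> proj1_sig (A m) `<=` proj1_sig (A n).
  elim: m => [|m IH]; first by rewrite leqn0 => /eqP ->.
  rewrite leq_eqVlt => /predU1P[->//|/IH]; apply: subset_trans; rewrite AS.
  by have := tP m; rewrite -/(t m); case: (t m) => -[[A' C] C'] a /= [_ []].
split => [n|n m].
  have := tP n; rewrite -/(t n).
  by case: (t n) => -[[A' C] C'] a /= [[? ? ?] _ _ [? ? ?]].
(* The sets of stage [k] lie in the [k]-th reserve and miss the next one; as reserves decrease, sets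
   of different stages are disjoint. *)
have CA k : (t k).1.1.2 `<=` proj1_sig (A k) /\ (t k).1.1.2 `&` proj1_sig (A k.+1) = set0.
  rewrite AS; have := tP k; rewrite -/(t k).
  by case: (t k) => -[[A' C] C'] a /= [_ [? ? ?] [h ? ?] _]; split=> //; rewrite setIC.
have C'A k : (t k).1.2 `<=` proj1_sig (A k) /\ (t k).1.2 `&` proj1_sig (A k.+1) = set0.
  rewrite AS; have := tP k; rewrite -/(t k).
  by case: (t k) => -[[A' C] C'] a /= [_ [? ? ?] [? h ?] _]; split=> //; rewrite setIC.
apply/seteqP; split => // x [C'x Cx].
have [nm|mn|nm] := ltngtP n m.
- have [_ <-] := C'A n; split => //; have [h _] := CA m.
  exact: (Adec _ _ nm _ (h _ Cx)).
- have [_ <-] := CA m; split => //; have [h _] := C'A n.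
  exact: (Adec _ _ mn _ (h _ C'x)).
- move: C'x Cx; rewrite nm; have := tP m; rewrite -/(t m).
  case: (t m) => -[[A' C] C'] a /= [_ _ [_ _ h] _] C'x Cx.
  by have : (C `&` C') x; [split|rewrite h].
Qed.

End slabs.

(** * Averages as functionals on the state space *)

Section mean_value.
Context {R : realType} (D : lifted_kernel R) (B : set R) (M : R).
Local Notation mu := (lift_mu D).
Local Notation r := (lift_r D).
Local Notation S := (msupport mu).
Hypotheses (BS : B `<=` S) (M0 : 0 <= M).
Local Open Scope quotient_scope.

(** [repr] picks an arbitrary member of a class, so pointwise identities about it are available only
    almost everywhere on the support. *)
Lemma repr_eqH (f : L2rep D) :
  {ae mu, forall x, S x -> repr (\pi_(Hmu D) f) x = f x}.
Proof. by apply/eqH/eqP; rewrite reprK. Qed.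

Lemma eqH_repr (u v : Hmu D) :
  {ae mu, forall x, S x -> repr u x = repr v x} -> u = v.
Proof. by move=> h; rewrite -(reprK u) -(reprK v); apply/eqP/eqH. Qed.

Lemma repr_linear (a : R) (u v : Hmu D) :
  {ae mu, forall x, S x -> repr (a *: u + v) x = a * repr u x + repr v x}.
Proof.
have -> : a *: u + v = \pi_(Hmu D) (a *: repr u + repr v).
  by rewrite pi_HD reprK.
exact: repr_eqH.
Qed.

Lemma repr_expH (t : R) (u : Hmu D) : 0 <= t ->
  {ae mu, forall x, S x -> repr (expH t u) x = expR (- x * t) * repr u x}.
Proof. by move=> t0; exact: toH_eq (exp_L2fun u t0). Qed.

Lemma repr_scaleH (a : R) (u : Hmu D) :
  {ae mu, forall x, S x -> repr (a *: u) x = a * repr u x}.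
Proof. exact: repr_eqH. Qed.

Lemma expHZ (t a : R) (u : Hmu D) : 0 <= t -> expH t (a *: u) = a *: expH t u.
Proof.
move=> t0; apply: eqH_repr.
have FF : Filter (almost_everywhere mu) := ae_filter_ringOfSetsType mu.
have h1 : {ae mu, forall x, S x ->
    repr (expH t (a *: u)) x = expR (- x * t) * (a * repr u x)}.
  apply: (filterS2 _ _ (repr_expH (a *: u) t0) (repr_scaleH a u)).
  by move=> x h h' Sx; rewrite h// h'.
have h2 : {ae mu, forall x, S x ->
    repr (a *: expH t u) x = a * (expR (- x * t) * repr u x)}.
  apply: (filterS2 _ _ (repr_expH u t0) (repr_scaleH a (expH t u))).
  by move=> x h h' Sx; rewrite h'// h.
by apply: (filterS2 _ _ h1 h2) => x h h' Sx; rewrite h// h'// mulrCA.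
Qed.

Definition mean (A : set R) (f : R -> R) : R :=
  fine (\int[mu]_(x in A) (f x)%:E) / fine (mu A).

Section slab_mean.
Variable A : set R.
Hypothesis sA : slab D B M A.

Let mA : measurable A. Proof. by case: sA. Qed.
Let AS : A `<=` S. Proof. by case: sA => _ AB _ _; exact: subset_trans BS. Qed.
Let AM : A `<=` `[0, M]. Proof. by case: sA. Qed.
Let Aoo : (mu A < +oo)%E. Proof. exact: slab_lty sA. Qed.
Let Afin : mu A \is a fin_num. Proof. by rewrite ge0_fin_numE. Qed.
Let A0 : 0 < fine (mu A).
Proof. by rewrite fine_gt0// Aoo andbT; case: sA. Qed.

Lemma weight_slab x : A x -> 0 < r M <= r x.
Proof.
move=> /AM; rewrite /= in_itv/= => /andP[x0 xM].
have [h1 _ h3 _] := lift_rP D; have [-> _ _] := h3 _ M0.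
by rewrite h1.
Qed.

(** A substitute for Cauchy-Schwarz: pointwise [y <= e + y ^+ 2 / e], and [r M <= r x] on the slab.
    The free parameter [e] is set to 1 for integrability and to the norm of [u] for the operator
    bound. *)
Lemma slab_abs_le (u : Hmu D) (e : R) : 0 < e ->
  (\int[mu]_(x in A) `|(repr u x)%:E| <=
    (e * fine (mu A) + `|u| ^+ 2 / (e * r M))%:E)%E.
Proof.
move=> e0.
have rM0 : 0 < r M.
  by have [_ _ h _] := lift_rP D; have [] := h _ M0.
have mS : measurable (S : set (measurableTypeR R)) by exact: measurable_support.
have mrf : measurable_fun (S : set (measurableTypeR R))
    (fun x => (r x * `|repr u x| ^+ 2)%:E).
  apply/measurable_EFinP; apply: measurable_funM; first exact: measurable_weight.
  apply: (@measurableT_comp _ _ _ _ _ _ (fun x : R => x ^+ 2)) => //.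
  by apply: measurableT_comp => //; apply: measurable_funTS; exact: mL2.
have rf0 x : S x -> (0 <= (r x * `|repr u x| ^+ 2)%:E)%E.
  by move=> Sx; rewrite lee_fin mulr_ge0 ?exprn_ge0// ltW// weight_gt0.
have k0 : 0 <= (e * r M)^-1 by rewrite invr_ge0 mulr_ge0// ltW.
apply: (@le_trans _ _ (\int[mu]_(x in A)
    (e%:E + (e * r M)^-1%:E * (r x * `|repr u x| ^+ 2)%:E))%E).
  apply: ge0_integral_mono => // x Ax; have /andP[_ rx] := weight_slab Ax.
  rewrite -EFinM -EFinD abse_EFin lee_fin; set y := `|_|.
  have y0 : 0 <= y by exact: normr_ge0.
  apply: (@le_trans _ _ (e + (e * r M)^-1 * (r M * y ^+ 2))); last first.
    by rewrite lerD2l ler_wpM2l// ler_wpM2r// exprn_ge0.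
  rewrite (_ : _ * _ = y ^+ 2 / e); last by field; rewrite !gt_eqF.
  rewrite -(ler_pM2l e0) mulrDr mulrC (mulrC e (_ / e)) divfK ?gt_eqF//.
  by have := sqr_ge0 (e - y); rewrite sqrrB => h; nra.
have mrfA : measurable_fun A (fun x => (r x * `|repr u x| ^+ 2)%:E).
  exact: measurable_funS mrf.
have rfA0 x : A x -> (0 <= (r x * `|repr u x| ^+ 2)%:E)%E by move=> /AS/rf0.
rewrite ge0_integralD//; last 3 first.
- by move=> x _; rewrite lee_fin ltW.
- by move=> x Ax; rewrite mule_ge0 ?rfA0.
- exact: measurable_funeM.
rewrite integral_cst//= EFinD; apply: leeD; first by rewrite EFinM fineK.
rewrite ge0_integralZl//.
have uE : (sqnorm D (repr u) = (`|u| ^+ 2)%:E)%E.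
  have /asboolP[_ uy] := L2valP (repr u).
  have q0 : (0 <= sqnorm D (repr u))%E by exact: integral_ge0.
  by rewrite normHE sqr_sqrtr ?fine_ge0// fineK// ge0_fin_numE.
rewrite [leRHS](_ : _ = ((e * r M)^-1)%:E * sqnorm D (repr u))%E; last first.
  by rewrite uE -EFinM mulrC.
apply: lee_wpmul2l; first by rewrite lee_fin.
exact: ge0_subset_integral.
Qed.

Lemma slab_integrable (u : Hmu D) : mu.-integrable A (EFin \o repr u).
Proof.
apply/integrableP; split.
  by apply/measurable_EFinP; apply: measurable_funTS; exact: mL2.
by apply: le_lt_trans (slab_abs_le u ltr01) _; rewrite ltry.
Qed.

Lemma mean_ae (f g : R -> R) : measurable_fun A f -> measurable_fun A g ->
  {ae mu, forall x, S x -> f x = g x} -> mean A f = mean A g.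
Proof.
move=> mf mg fg; congr (fine _ / _); apply: ae_eq_integral => //.
- exact/measurable_EFinP.
- exact/measurable_EFinP.
by apply: (@filterS _ _ (ae_filter_ringOfSetsType mu)) fg => x fg /AS /fg /= ->.
Qed.

Lemma mean_scalar : scalar (fun u : Hmu D => mean A (repr u)).
Proof.
move=> a u v.
rewrite (@mean_ae _ (fun x => a * repr u x + repr v x)); last exact: repr_linear.
- rewrite /mean /=.
  have iu := slab_integrable u; have iv := slab_integrable v.
  rewrite (_ : (\int[mu]_(x in A) (a * repr u x + repr v x)%:E =
    a%:E * \int[mu]_(x in A) (repr u x)%:E + \int[mu]_(x in A) (repr v x)%:E)%E).
    rewrite fineD ?fineM ?fin_numM ?integrable_fin_num//.
    by rewrite mulrDl mulrA.
  rewrite -integralZl// -integralD//; last exact: integrableZl.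
- apply: measurable_funTS; exact: mL2.
- apply: measurable_funTS; apply: measurable_funD; last exact: mL2.
  by apply: measurable_funM => //; exact: mL2.
Qed.

(** Taking [e] equal to the norm of [u] in [slab_abs_le] makes the bound homogeneous and produces
    the constant; [u = 0] is set apart since [e] must be positive. *)
Lemma mean_le (u : Hmu D) :
  `|mean A (repr u)| <= (1 + (r M * fine (mu A))^-1) * `|u|.
Proof.
have [->|u0] := eqVneq u 0.
  have -> : mean A (repr (0 : Hmu D)) = 0.
    have := mean_scalar 1 0 0; rewrite /= scale1r addr0 mul1r => h.
    by apply: (addrI (mean A (repr (0 : Hmu D)))); rewrite -h addr0.
  by rewrite !normr0 mulr0.
have rM0 : 0 < r M.
  by have [_ _ h _] := lift_rP D; have [] := h _ M0.
have N0 : 0 < `|u| by rewrite normr_gt0.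
rewrite /mean normrM (gtr0_norm (x := _^-1)) ?invr_gt0// ler_pdivrMr//.
have iu := slab_integrable u.
have h : (`|\int[mu]_(x in A) (repr u x)%:E| <=
    (`|u| * fine (mu A) + `|u| ^+ 2 / (`|u| * r M))%:E)%E.
  apply: le_trans (slab_abs_le u N0); apply: le_abse_integral => //.
  exact: measurable_int iu.
rewrite -lee_fin; apply: le_trans (le_trans h _).
  by rewrite -abse_EFin fineK// integrable_fin_num.
rewrite lee_fin le_eqVlt; apply/orP; left; apply/eqP.
by field; rewrite !gt_eqF.
Qed.

Lemma mean_bounds (f : R -> R) (lo hi : R) : measurable_fun A f ->
  (forall x, A x -> lo <= f x <= hi) -> lo <= mean A f <= hi.
Proof.
move=> mf h.
have cI c : mu.-integrable A (cst c%:E).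
  apply/integrableP; split => //.
  by rewrite integral_cst// lte_mul_pinfty.
have fi : mu.-integrable A (EFin \o f).
  apply: (le_integrable _ _ _ (cI (`|lo| + `|hi|))) => //.
    exact/measurable_EFinP.
  move=> x /h /andP[lf fh].
  change ((`|f x|)%:E <= (`| (`|lo| + `|hi|) |)%:E)%E.
  rewrite lee_fin [leRHS]ger0_norm ?addr_ge0//.
  rewrite ler_norml; have := ler_norm hi; have := normr_ge0 hi.
  have := normr_ge0 lo; have := ler_norm (- lo); rewrite normrN.
  by move=> *; apply/andP; split; lra.
have meanC c : fine (\int[mu]_(x in A) c%:E) = c * fine (mu A).
  by rewrite integral_cst//= fineM.
rewrite /mean ler_pdivlMr// ler_pdivrMr// -!meanC.
rewrite !fine_le ?integrable_fin_num//; try exact: cI.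
  by apply: le_integral => //; [exact: cI|move=> x /set_mem /h /andP[]; rewrite lee_fin].
by apply: le_integral => //; [exact: cI|move=> x /set_mem /h /andP[]; rewrite lee_fin].
Qed.

End slab_mean.

End mean_value.

Section mean_difference.
Context {R : realType} (D : lifted_kernel R) (B : set R) (M : R).
Local Notation mu := (lift_mu D).
Local Notation S := (msupport mu).
Hypotheses (BS : B `<=` S) (M0 : 0 <= M).
Local Notation mean := (mean D).

Lemma measurable_exp_mul (t : R) :
  measurable_fun setT (fun x : R => expR (- x * t)).
Proof.
apply: measurableT_comp; first exact: measurable_expR.
by apply: measurable_funM => //; exact: oppr_measurable.
Qed.

Lemma mean_expH_one (A : set R) (t : R) : slab D B M A -> 0 <= t ->
  mean A (repr (expH t (oneH D))) = mean A (fun x => expR (- x * t)).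
Proof.
move=> sA t0; apply: (mean_ae BS sA).
- by apply: measurable_funTS; exact: mL2.
- by apply: measurable_funTS; exact: measurable_exp_mul.
have FF : Filter (almost_everywhere mu) := ae_filter_ringOfSetsType mu.
apply: (filterS2 _ _ (repr_expH (oneH D) t0) (toH_eq (one_L2fun D))).
by move=> x h h' Sx; rewrite h// (h' Sx : repr (oneH D) x = 1) mulr1.
Qed.

(** For the lower bound, [1 - e * t <= exp (- (e * t))] is multiplied by [exp (- a * t)]; as this
    factor is at most 1, the loss is at most [e * t]. *)
Lemma exp_mul_bounds (a e t x : R) : 0 <= a -> 0 <= e -> 0 <= t ->
  a <= x <= a + e -> expR (- a * t) - e * t <= expR (- x * t) <= expR (- a * t).
Proof.
move=> a0 e0 t0 /andP[ax xae].
apply/andP; split; last by rewrite ler_expR !mulNr lerN2 ler_wpM2r.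
have h1 : expR (- a * t) * expR (- (e * t)) <= expR (- x * t).
  by rewrite -expRD ler_expR !mulNr -opprD lerN2 -mulrDl ler_wpM2r.
apply: le_trans h1.
have h2 := expR_ge1Dx (- (e * t)).
have h3 : expR (- a * t) <= 1.
  by rewrite -expR0 ler_expR mulNr oppr_le0 mulr_ge0.
have h4 := expR_ge0 (- a * t); have h5 : 0 <= e * t by rewrite mulr_ge0.
have : expR (- a * t) * (1 - e * t) <= expR (- a * t) * expR (- (e * t)).
  by rewrite ler_wpM2l.
by nra.
Qed.

(** Both averages lie in the same interval of length [e * t], the one of [exp_mul_bounds]. *)
Lemma mean_exp_diff (A A' : set R) (a e t : R) :
  slab D B M A -> slab D B M A' -> 0 <= a -> 0 <= e -> 0 <= t ->
  A `<=` `[a, a + e] -> A' `<=` `[a, a + e] ->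
  `|mean A (repr (expH t (oneH D))) - mean A' (repr (expH t (oneH D)))| <= e * t.
Proof.
move=> sA sA' a0 e0 t0 Aa A'a; rewrite !mean_expH_one//.
have mexp E : measurable_fun E (fun x : R => expR (- x * t)).
  by apply: measurable_funTS; exact: measurable_exp_mul.
have bd E : E `<=` `[a, a + e] -> forall x, E x ->
    expR (- a * t) - e * t <= expR (- x * t) <= expR (- a * t).
  by move=> Ea x /Ea; rewrite /= in_itv/=; exact: exp_mul_bounds.
have /andP[h1 h2] := mean_bounds sA (mexp _) (bd _ Aa).
have /andP[h3 h4] := mean_bounds sA' (mexp _) (bd _ A'a).
by rewrite ler_norml; apply/andP; split; lra.
Qed.

Lemma mean_difference_functional (A A' : set R) :
  slab D B M A -> slab D B M A' ->
  exists (l : {scalar Hmu D}) (C : R), [/\ 0 < C, forall u, `|l u| <= C * `|u|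
    & forall u, l u = mean A (repr u) - mean A' (repr u)].
Proof.
move=> sA sA'.
pose f (u : Hmu D) : R := mean A (repr u) - mean A' (repr u).
have fs : scalar f.
  move=> a u v; rewrite /f (mean_scalar BS M0 sA a u v) (mean_scalar BS M0 sA' a u v).
  by rewrite /=; ring.
pose l : {scalar Hmu D} := HB.pack f (GRing.isLinear.Build _ _ _ _ f fs).
have hr A0 : slab D B M A0 -> 0 <= (lift_r D M * fine (mu A0))^-1.
  move=> sA0; rewrite invr_ge0; apply: mulr_ge0; last exact: fine_ge0.
  by have [_ _ h _] := lift_rP D; have [/ltW] := h _ M0.
have h := hr _ sA; have h' := hr _ sA'.
exists l, (1 + (lift_r D M * fine (mu A))^-1 + (1 + (lift_r D M * fine (mu A'))^-1)).
split => // [|u]; first by lra.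
rewrite /l /= /f (le_trans (ler_normB _ _))// mulrDl lerD//.
  exact: (mean_le BS M0 sA).
exact: (mean_le BS M0 sA').
Qed.

Lemma mean_indic (A E : set R) : slab D B M A -> measurable E ->
  mean A \1_E = fine (mu (E `&` A)) / fine (mu A).
Proof.
by move=> [mA _ _ _] mE; rewrite /mean integral_indic.
Qed.

End mean_difference.

(** * The linear subspace of finite energy and its shifts *)

Section energy.
Context {R : realType} (V : normedModType R) (l : nat -> {scalar V}).

(** The subspace called G in the overview. *)
Definition finite_energy : set V :=
  [set u | (\sum_(n <oo) (l n u ^+ 2)%:E < +oo)%E].

Lemma finite_energy_measurable :
  (forall n, exists C, forall u, `|l n u| <= C * `|u|) ->
  measurable (finite_energy : set (borel V)).
Proof.
move=> hl; have ml n : measurable_fun setT (fun u : borel V => (l n u ^+ 2)%:E).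
  have [C lC] := hl n; apply/measurable_EFinP; apply: measurable_funX.
  exact: scalar_borel_measurable lC.
have := @emeasurable_fun_infty_o _ _ _ setT
  (fun u : borel V => \sum_(n <oo) (l n u ^+ 2)%:E)%E measurableT _ +oo%E.
rewrite setTI; apply; apply: ge0_emeasurable_sum => //.
by move=> n x _ _; rewrite lee_fin sqr_ge0.
Qed.

(** Since [l n v = l n (v + u) - l n u], finite energy of both [u] and [v + u] would pass to [v],
    whose terms are at least [c ^+ 2]. *)
Lemma finite_energy_shift (u v : V) : finite_energy u ->
  (exists2 c, 0 < c & forall n, c <= `|l n v|) -> ~ finite_energy (v + u).
Proof.
move=> Gu [c c0 cv] Gvu.
have p n w : (0 <= (l n w ^+ 2)%:E)%E by rewrite lee_fin sqr_ge0.
have key : (\sum_(n <oo) (c ^+ 2)%:E < +oo)%E.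
  apply: (@le_lt_trans _ _ (\sum_(n <oo)
      (2%:E * (l n (v + u) ^+ 2)%:E + 2%:E * (l n u ^+ 2)%:E)))%E.
    apply: lee_nneseries => [n _ _|n _]; first by rewrite lee_fin sqr_ge0.
    rewrite -!EFinM -EFinD lee_fin.
    have : c ^+ 2 <= l n v ^+ 2.
      by rewrite -[leRHS](real_normK (num_real _)) ler_pXn2r ?nnegrE ?cv// ltW.
    move=> h; apply: (le_trans h); rewrite linearD /=.
    by have := sqr_ge0 (l n v + 2 * l n u); rewrite !sqrrD; nra.
  rewrite nneseriesD; last 2 first.
  - by move=> n _ _; rewrite mule_ge0.
  - by move=> n _ _; rewrite mule_ge0.
  by rewrite !nneseriesZl// lte_add_pinfty// lte_mul_pinfty.
have c2 : 0 < c ^+ 2 by rewrite exprn_gt0.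
move: key; rewrite ltNge => /negP; apply; rewrite leye_eq; apply/eqP/eqyP => A A0.
(* So many terms equal to [c ^+ 2] already reach the arbitrary bound [A]. *)
pose N := (Num.truncn (A / c ^+ 2)).+1.
apply: (@le_trans _ _ (\sum_(0 <= i < N) (c ^+ 2)%:E)%E); last first.
  by apply: nneseries_lim_ge => n _ _; rewrite lee_fin ltW.
rewrite sumEFin lee_fin big_const_nat subn0 iter_addr_0 -[leRHS]mulr_natl.
by rewrite -ler_pdivrMr// ltW// truncnS_gt.
Qed.

Context d (Omega : measurableType d) (P : probability Omega R).

(** By Tonelli the expected energy is finite, so the energy is finite almost surely. *)
Lemma finite_energy_ae (X : Omega -> V) :
  (forall n, exists C, forall u, `|l n u| <= C * `|u|) -> random_element X ->
  (\sum_(n <oo) \int[P]_w (l n (X w) ^+ 2)%:E < +oo)%E ->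
  {ae P, forall w, finite_energy (X w)}.
Proof.
move=> hl rX; have mlX n : measurable_fun setT (fun w => (l n (X w) ^+ 2)%:E).
  have [C lC] := hl n; apply/measurable_EFinP; apply: measurable_funX.
  exact: (measurableT_comp (scalar_borel_measurable lC) rX).
have p n w : (0 <= (l n (X w) ^+ 2)%:E)%E by rewrite lee_fin sqr_ge0.
rewrite -integral_nneseries// => h.
have : P.-integrable setT (fun w => \sum_(n <oo) (l n (X w) ^+ 2)%:E)%E.
  apply/integrableP; split; first exact: ge0_emeasurable_sum.
  by under eq_integral do rewrite gee0_abs ?nneseries_ge0//.
move=> /(integrable_ae measurableT); apply: filterS => w /(_ Logic.I).
by rewrite ge0_fin_numE ?nneseries_ge0.
Qed.

End energy.

(** * Failure of the strong Feller property *)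

Section lifted_equation.
Context (R : realType) (D : lifted_kernel R).
Local Notation mu := (lift_mu D).
Local Notation S := (msupport mu).

(** The factor [expR (x * t)], meant to undo the semigroup, is bounded by [expR (M * t)] on [E], and
    the weight has finite integral over the support. *)
Lemma exp_indic_L2fun (t M : R) (E : set R) : 0 <= t -> measurable E ->
  E `<=` `[0, M] -> (fun x => expR (x * t) * \1_E x) \in L2fun D.
Proof.
move=> t0 mE EM.
have mf : measurable_fun setT (fun x : R => expR (x * t) * \1_E x).
  apply: measurable_funM; last exact: measurable_indic.
  by apply: measurableT_comp => //; apply: measurable_funM.
apply/asboolP; split => //.
have [_ _ _ rS] := lift_rP D.
have mS : measurable (S : set (measurableTypeR R)) by exact: measurable_support.
have mr : measurable_fun (S : set (measurableTypeR R)) (fun x => (lift_r D x)%:E).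
  by apply/measurable_EFinP; exact: measurable_weight.
have r0 x : S x -> (0 <= (lift_r D x)%:E)%E.
  by move=> Sx; rewrite lee_fin ltW// weight_gt0.
apply: (@le_lt_trans _ _ (\int[mu]_(x in S)
    ((expR (M * t) ^+ 2)%:E * (lift_r D x)%:E))%E).
  apply: ge0_integral_mono => [x Sx|x Sx].
    by rewrite lee_fin mulr_ge0 ?exprn_ge0// -lee_fin r0.
  rewrite -EFinM lee_fin mulrC ler_wpM2r ?(ltW (weight_gt0 Sx))//.
  rewrite ler_pXn2r ?nnegrE ?expR_ge0// indicE.
  have [xE|xE] := boolP (x \in E); last by rewrite mulr0 normr0 expR_ge0.
  rewrite mulr1 ger0_norm ?expR_ge0// ler_expR ler_wpM2r//.
  by have := EM _ (set_mem xE); rewrite /= in_itv/= => /andP[].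
have k0 : 0 <= expR (M * t) ^+ 2 by rewrite exprn_ge0 ?expR_ge0.
by rewrite ge0_integralZl ?lee_fin// lte_mul_pinfty ?lee_fin.
Qed.

Lemma repr_exp_indic (t M : R) (E : set R) : 0 <= t -> measurable E ->
  E `<=` `[0, M] ->
  {ae mu, forall x, S x ->
    repr (expH t (toH D (fun x => expR (x * t) * \1_E x))) x = \1_E x}.
Proof.
move=> t0 mE EM.
have FF : Filter (almost_everywhere mu) := ae_filter_ringOfSetsType mu.
set g := fun x => expR (x * t) * \1_E x.
apply: (filterS2 _ _ (repr_expH (toH D g) t0) (toH_eq (exp_indic_L2fun t0 mE EM))).
move=> x h h' Sx; rewrite h// h'// mulrA -expRD.
by rewrite mulNr addNr expR0 mul1r.
Qed.

Lemma separating_functionals (B : set R) (t : R) :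
  measurable B -> B `<=` S -> (0 < mu B)%E -> atomless_on mu B -> 0 <= t ->
  exists (l : nat -> {scalar Hmu D}) (C : nat -> R) (y : Hmu D),
  [/\ forall n, 0 < C n, forall n u, `|l n u| <= C n * `|u|,
    forall n s, 0 <= s -> `|l n (expH s (oneH D))| <= (2 ^ n.+1)%:R^-1 * s
    & forall n, l n (expH t y) = 1].
Proof.
move=> mB BS B0 aB t0.
(* Some bounded part of [B] has positive measure; it fixes the bound [M] of all slabs. *)
have [m mpos] : exists m, (0 < mu (B `&` `[0%R, m%:R]%classic))%E.
  apply: (@cover_gt0 _ _ _ mu B (fun m => `[0%R, m%:R]%classic)) => // x /BS Sx.
  exists (Num.truncn x).+1 => //=; rewrite in_itv/= (support_ge0 Sx)/=.
  by rewrite ltW// truncnS_gt.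
pose M : R := m%:R; have M0 : 0 <= M by rewrite ler0n.
have sA0 : slab D B M (B `&` `[0, M]).
  by split => //; exact: measurableI.
have e0 n : 0 < (2 ^ n.+1)%:R^-1 :> R by rewrite invr_gt0 ltr0n expn_gt0.
have [A [A' [a [hA disj]]]] := slab_sequence aB sA0 e0.
have sA n : slab D B M (A n) by have [] := hA n.
have sA' n : slab D B M (A' n) by have [] := hA n.
have /choice[lC hlC] : forall n, exists lC : {scalar Hmu D} * R,
    [/\ 0 < lC.2, forall u, `|lC.1 u| <= lC.2 * `|u|
    & forall u, lC.1 u = mean D (A n) (repr u) - mean D (A' n) (repr u)].
  by move=> n; have [l [C h]] := mean_difference_functional BS M0 (sA n) (sA' n);
    exists (l, C).
pose E := \bigcup_n A n.
have mE : measurable E by apply: bigcup_measurable => n _; have [] := sA n.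
have EM : E `<=` `[0, M] by move=> x [n _]; have [_ _ AM _] := sA n; exact: AM.
exists (fun n => (lC n).1), (fun n => (lC n).2),
  (toH D (fun x => expR (x * t) * \1_E x)).
split => [n|n u|n s s0|n]; first by have [] := hlC n.
- by have [_ + _] := hlC n; exact.
- have [_ _ ->] := hlC n; have [_ _ a0 Aa A'a] := hA n.
  exact: (mean_exp_diff BS (sA n) (sA' n) a0 (ltW (e0 n)) s0 Aa A'a).
have [_ _ ->] := hlC n.
have meanE G : slab D B M G -> mean D G (repr
    (expH t (toH D (fun x => expR (x * t) * \1_E x)))) = mean D G \1_E.
  move=> sG; apply: (mean_ae BS sG); last exact: (repr_exp_indic t0 mE EM).
    by apply: measurable_funTS; exact: mL2.
  by apply: measurable_funTS; exact: measurable_indic.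
rewrite !meanE// (mean_indic (sA n) mE) (mean_indic (sA' n) mE).
rewrite (_ : E `&` A n = A n); last by apply/setIidr => x Ax; exists n.
(* [A' n] avoids the whole union [E], so the average of [\1_E] is 1 over [A n] and 0 over [A' n]. *)
rewrite (_ : E `&` A' n = set0); last first.
  by apply/seteqP; split => // x [[k _ Ax] A'x]; rewrite -(disj n k).
rewrite measure0 mul0r subr0 divff// gt_eqF// fine_gt0//.
by rewrite (slab_lty (sA n)) andbT; have [] := sA n.
Qed.

Context d (Omega : measurableType d) (P : probability Omega R).
Variables (F : R -> set (set Omega)) (W : R -> Omega -> R).
Hypotheses (hF : usual_filtration P F) (hW : brownian_motion P F W).

(** With [e = 2^-(n+1)] the integrand satisfies the bound [k = e * t], so the second moment is at
    most [q * e ^+ 2] for [q = 4 * kappa * t ^+ 3]. As [e <= 1], the series is dominated by a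
    geometric one with sum at most [q]. *)
Lemma ito_integral_finite_energy (l : nat -> {scalar Hmu D}) (C : nat -> R)
    (t : R) (X : Omega -> Hmu D) :
  0 <= t -> (forall n, 0 < C n) -> (forall n u, `|l n u| <= C n * `|u|) ->
  (forall n s, 0 <= s -> `|l n (expH s (oneH D))| <= (2 ^ n.+1)%:R^-1 * s) ->
  ito_integral P F W t (fun s _ => expH (t - s) (oneH D)) X ->
  {ae P, forall w, finite_energy l (X w)}.
Proof.
move=> t0 C0 lC lk iX.
apply: finite_energy_ae; first by move=> n; exists (C n); exact: lC.
  by have [] := iX.
have k0 := std_normal_variance_ge0 R.
pose q : R := 4 * std_normal_variance R * t ^+ 3.
have q0 : 0 <= q by rewrite /q mulr_ge0 ?exprn_ge0// mulr_ge0.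
apply: (@le_lt_trans _ _ (\sum_(n <oo) (q / (2 ^ n.+1)%:R)%:E)%E); last first.
  by apply: le_lt_trans (epsilon_trick0 _ q0) _; rewrite ltry.
apply: lee_nneseries => [n _ _|n _].
  by apply: integral_ge0 => w _; rewrite lee_fin sqr_ge0.
pose e : R := (2 ^ n.+1)%:R^-1.
have e0 : 0 <= e by rewrite invr_ge0.
have e1 : e <= 1 by rewrite invf_le1 ?ltr0n ?expn_gt0// ler1n expn_gt0.
have lk' s (w : Omega) : 0 <= s <= t -> `|l n (expH (t - s) (oneH D))| <= e * t.
  move=> /andP[s0 st]; apply: (le_trans (lk n _ _)); first by rewrite subr_ge0.
  by rewrite ler_wpM2l// lerBlDr lerDl.
apply: le_trans (ito_functional_sqr_le hF hW (C0 n) (lC n) t0 lk' iX) _.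
rewrite lee_fin -/e (_ : _ * _ = q * e ^+ 2); last by rewrite /q; ring.
by rewrite ler_wpM2l// expr2 ler_piMr.
Qed.

Variable Y : Hmu D -> R -> Omega -> Hmu D.
Hypothesis hY : forall y, mild_solution P F W y (Y y).

Lemma transition_ae_cst (t c : R) (f : Hmu D -> R) (y : Hmu D) :
  0 <= t -> bounded_borel f -> {ae P, forall w, f (Y y t w) = c} ->
  transition P Y t f y = c.
Proof.
move=> t0 [_ mf] fc; have [rY _] := hY y t0.
rewrite /transition unlock (ae_eq_integral (cst c%:E)) => //.
- by rewrite integral_cst//= probability_setT mule1.
- by apply/measurable_EFinP; exact: (measurableT_comp mf rY).
by apply: filterS fc => w /= -> _.
Qed.

Lemma transition_not_continuous (B : set R) (t : R) :
  measurable B -> B `<=` S -> (0 < mu B)%E -> atomless_on mu B -> 0 < t ->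
  exists f : Hmu D -> R, bounded_borel f /\ ~ continuous (transition P Y t f).
Proof.
move=> mB BS B0 aB t0; have t0' := ltW t0.
have [l [C [y [C0 lC lk ly]]]] := separating_functionals mB BS B0 aB t0'.
have mG : measurable (finite_energy l : set (borel (Hmu D))).
  by apply: finite_energy_measurable => n; exists (C n).
pose f : Hmu D -> R := \1_(finite_energy l).
have bf : bounded_borel f.
  split; last exact: (@measurable_indic _ (borel (Hmu D))).
  by exists 1 => u; rewrite /f indicE; case: (_ \in _); rewrite ?normr1 ?normr0.
(* Each mild solution comes with its own version of the Ito integral, so [X] may depend on [a]; what
   matters is that every version lies in the subspace. *)
have solE (a : R) : exists2 X : Omega -> Hmu D,
    {ae P, forall w, finite_energy l (X w)} &
    {ae P, forall w, Y (a *: y) t w = a *: expH t y + X w}.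
  have [_ [X iX YX]] := hY (a *: y) t0'.
  exists X; first exact: (ito_integral_finite_energy t0' C0 lC lk iX).
  by rewrite -expHZ.
have P0 : transition P Y t f 0 = 1.
  apply: transition_ae_cst => //; have [X GX YX] := solE 0.
  rewrite scale0r in YX; apply: filterS2 GX YX => w GX ->.
  by rewrite scale0r add0r /f indicE mem_set.
have Pa (a : R) : 0 < a -> transition P Y t f (a *: y) = 0.
  move=> a0; apply: transition_ae_cst => //; have [X GX YX] := solE a.
  apply: filterS2 GX YX => w GX ->; rewrite /f indicE memNset//.
  apply: finite_energy_shift GX _; exists a => // n.
  by rewrite linearZ /= ly mulr1 ler_norm.
exists f; split => // /(_ 0) cf.
(* [harmonic n] is positive, so the transition function is 0 all along this sequence, whereas it is
   1 at the limit point. *)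
have c1 : (fun n : nat => harmonic n *: y) @ \oo --> (0 : Hmu D).
  rewrite -(scale0r y); apply: cvgZr_tmp.
  exact: cvg_harmonic.
have := cvg_comp _ _ c1 cf; rewrite P0 => c2.
have c3 : (transition P Y t f \o (fun n : nat => harmonic n *: y)) @ \oo --> (0 : R).
  rewrite (_ : _ \o _ = cst 0); first exact: cvg_cst.
  by apply/funext => n /=; rewrite Pa// /harmonic /= invr_gt0.
have := oner_neq0 R; rewrite -[X in X != _](cvg_lim _ c2)//.
by rewrite (cvg_lim _ c3)// eqxx.
Qed.

End lifted_equation.

Theorem theorem3p3 (R : realType) (D : lifted_kernel R)
  (d : measure_display) (Omega : measurableType d) (P : probability Omega R)
  (F : R -> set (set Omega)) (W : R -> Omega -> R)
  (hF : usual_filtration P F) (hW : brownian_motion P F W)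
  (Y : Hmu D -> R -> Omega -> Hmu D)
  (hY : forall y : Hmu D, mild_solution P F W y (Y y))
  (hB : exists B : set R,
    [/\ measurable B, B `<=` msupport (lift_mu D), (0 < lift_mu D B)%E
      & atomless_on (lift_mu D) B]) :
  ~ strongly_feller P Y /\
  forall t : R, 0 < t ->
    exists f : Hmu D -> R,
      bounded_borel f /\ ~ continuous (transition P Y t f).
Proof.
have [B [mB BS B0 aB]] := hB.
have main t : 0 < t -> exists f : Hmu D -> R,
    bounded_borel f /\ ~ continuous (transition P Y t f).
  exact: (transition_not_continuous hF hW hY mB BS B0 aB).
(* The negated property quantifies over all positive times; time 1 is an arbitrary choice. *)
split => // sf; have [f [bf]] := main 1 ltr01.
by apply; exact: sf.
Qed.
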